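(* Let $A=R/I$ be a graded Artinian Gorenstein algebra of socle degree $j$ with $I_2=\langle w^2,wx,wy\rangle$, and let $H=H(R/I)$. Then (i) $\Delta H_{\le j/2}$ is an $O$-sequence, and (ii) $H=H'+(0,1,1,\dots,1,0)$ for some Gorenstein sequence $H'$ of height three.
   Context: $K$ algebraically closed, $R=K[w,x,y,z]$ standard graded. For $H=(h_0,\dots,h_j)$, $\Delta H_i=h_i-h_{i-1}$ ($h_{-1}=0$) and $\Delta H_{\le j/2}=(\Delta H_i)_{0\le i\le j/2}$. For $c,d>0$ write $c=\sum_{i=1}^d\binom{k(i)}{i}$ with $k(d)>\dots>k(1)\ge0$ and $c^{(d)}=\sum_{i=1}^d\binom{k(i)+1}{i+1}$, $0^{(d)}=0$; an $O$-sequence is a sequence $(1,t_1,t_2,\dots)$ of nonnegative integers with $t_{d+1}\le t_d^{(d)}$ for all $d\ge1$. A Gorenstein sequence of height three is the Hilbert function of a graded Artinian Gorenstein quotient of $K[x,y,z]$ with $h_1=3$. The sequence $(0,1,\dots,1,0)$ has length $j+1$. *)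

(* Defs.v *)
From HB Require Import structures.
From mathcomp Require Import all_boot all_order all_algebra.
From mathcomp Require Import mpoly.

Set Implicit Arguments.
Unset Strict Implicit.
Unset Printing Implicit Defensive.

Import GRing.Theory.
Local Open Scope ring_scope.

Section Defs.
Variables (K : fieldType) (n : nat).
Local Notation P := {mpoly K[n]}.

Definition is_ideal (I : P -> Prop) : Prop :=
  [/\ I 0,
      (forall p q, I p -> I q -> I (p + q)) &
      (forall r p, I p -> I (r * p))].

Definition is_homogeneous_ideal (I : P -> Prop) : Prop :=
  is_ideal I /\ forall p d, I p -> I (pihomog mdeg d p).

Definition lin_indep_mod (I : P -> Prop) (s : seq P) : Prop :=
  forall c : 'I_(size s) -> K,
    I (\sum_(k < size s) c k *: s`_k) -> forall k, c k = 0.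

(* dim_K of (S + I)/I is N, where S is the set of elements satisfying Q,
   which in our uses is a K-subspace containing I. *)
Definition dim_mod (I : P -> Prop) (Q : P -> Prop) (N : nat) : Prop :=
  (exists s : seq P, [/\ size s = N, (forall q, q \in s -> Q q) & lin_indep_mod I s])
  /\ (forall s : seq P, (forall q, q \in s -> Q q) -> lin_indep_mod I s -> (size s <= N)%N).

Definition hilbert_function (I : P -> Prop) (H : nat -> nat) : Prop :=
  forall i, dim_mod I (fun p => p \is i.-homog) (H i).

Definition socle_pred (I : P -> Prop) (f : P) : Prop :=
  forall k : 'I_n, I (f * 'X_k).

(* graded Artinian: homogeneous ideal, R/I finite dimensional
   (all forms of some degree d lie in I) *)
Definition graded_artinian (I : P -> Prop) : Prop :=
  is_homogeneous_ideal I /\ exists d, forall p : P, p \is d.-homog -> I p.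

Definition graded_artinian_gorenstein (I : P -> Prop) : Prop :=
  graded_artinian I /\ dim_mod I (socle_pred I) 1.

End Defs.

Definition socle_degree (H : nat -> nat) (j : nat) : Prop :=
  (0 < H j)%N /\ forall i, (j < i)%N -> H i = 0%N.

Definition macaulay_rep (c d : nat) (k : nat -> nat) : Prop :=
  (forall i, (1 <= i)%N -> (i < d)%N -> (k i < k i.+1)%N) /\
  c = (\sum_(1 <= i < d.+1) 'C(k i, i))%N.

Definition macaulay_upper (d : nat) (k : nat -> nat) : nat :=
  (\sum_(1 <= i < d.+1) 'C((k i).+1, i.+1))%N.

(* t = (t_0, ..., t_L) is an O-sequence: t_0 = 1, t_i >= 0, and
   t_{d+1} <= t_d^{(d)} for d >= 1.  (For t_d = 0 the representation
   k i = i - 1 gives 0^{(d)} = 0, and representations are unique.) *)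
Definition O_sequence (t : seq int) : Prop :=
  [/\ t`_0 = 1,
      (forall i, (i < size t)%N -> 0 <= t`_i) &
      (forall d, (1 <= d)%N -> (d.+1 < size t)%N ->
         exists k, macaulay_rep (absz (nth 0%R t d)) d k /\
                   (absz (nth 0%R t d.+1) <= macaulay_upper d k)%N)].

Definition DeltaH_half (H : nat -> nat) (j : nat) : seq int :=
  [seq ((H i)%:Z - (if i is i'.+1 then (H i')%:Z else 0)) | i <- iota 0 (j./2).+1].

(* Main.v *)
(* Let l = z - a x. Exactness of R/I(-1) -> R/I -> R/(I, l) and the self-duality of
   multiplication by l on the Gorenstein algebra R/I give
   h_i - h_(i-1) = c_i - c_(j+1-i), where c is the Hilbert function of R/(I, l).
   Since w^2, wx, wy (and so wz modulo l) vanish there, R/(I, l) is in degrees >= 2 a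
   quotient of K[x, y], so c_i = i + 1 until the first generator appears and c is
   nonincreasing afterwards. For a generic, that generator appears in the least degree
   nu in which I contains a form not divisible by w, and multiplication by l is
   injective on R/I below nu - 1. Hence T = (1, 2, h_2 - h_1, h_3 - h_2, ...) satisfies
   T_d = d + 1 for d < nu and is nonincreasing from d = nu - 1 on, up to degree j/2.
   This gives the O-sequence property; and the sum of the evaluations in degree j at
   points of the plane with h-vector T is the dual generator of a Gorenstein algebra
   whose Hilbert function is H - (0, 1, ..., 1, 0). *)
Require Import Defs.
From HB Require Import structures.
From mathcomp Require Import all_boot all_order all_algebra.
From mathcomp Require Import mpoly.
From mathcomp Require Import zify ring.
From Stdlib Require Import Classical ClassicalEpsilon FunctionalExtensionality.
Import GRing.Theory VectorInternalTheory.
Local Open Scope ring_scope.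

Set Implicit Arguments.
Unset Strict Implicit.
Unset Printing Implicit Defensive.

(** * Linear algebra *)

Section LinearAlgebra.
Variable K : fieldType.

(** The dual generator is encoded as a linear functional [phi] on forms of degree [j], with pairing
    [phi (p * q)]; no differentiation occurs, so the argument works in every characteristic.
    Symmetry of the Hilbert function and of the ranks of multiplication by l both become the
    equality of the left and right ranks of a bilinear form. Injectivity of l in low degrees is the
    delicate point. Modulo w^2, wx, wy, a form all of whose monomials contain w reduces to a
    multiple of w z^i, and l sends w z^i to w z^(i+1). These stay outside I up to degree j: a last
    one in smaller degree would be killed by all four variables, hence lie in the socle, which lives
    in degree j. T has entry 2 rather than 3 in degree 1 because the h-vector of plane points is at
    most d + 1 in degree d. Its shape is what makes the set of cells (a, b) with a < T (a + b)
    closed under decreasing either coordinate, and grid points indexed by such a set have Newton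
    interpolation bases. *)

Definition is_subspace (V : lmodType K) (Q : V -> Prop) : Prop :=
  Q 0 /\ forall c u v, Q u -> Q v -> Q (c *: u + v).

Lemma subspace_vspace (V : vectType K) (Q : V -> Prop) :
  is_subspace Q -> exists W : {vspace V}, forall u, u \in W <-> Q u.
Proof.
move=> [Q0 QD].
(* A subspace contained in [Q] is enlarged by one vector at a time; [n] bounds its codimension. *)
suff H (n : nat) : forall W : {vspace V}, (forall u, u \in W -> Q u) ->
    (\dim {:V} - \dim W <= n)%N ->
    exists W : {vspace V}, forall u, u \in W <-> Q u.
  apply: (H (\dim {:V}) 0%VS); last by rewrite leq_subr.
  by move=> u; rewrite memv0 => /eqP->.
elim: n => [|n IHn] W WQ dW.
  exists W => u; split; first exact: WQ.
  have /eqP-> : W == fullv by rewrite eqEdim subvf /=; move: dW; lia.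
  by rewrite memvf.
case: (classic (forall u, Q u -> u \in W)) => [QW|].
  by exists W => u; split; [exact: WQ | exact: QW].
move=> NA; have [u Hu] := not_all_ex_not _ _ NA.
have [Qu /negP uW] := imply_to_and _ _ Hu.
apply: (IHn (<[u]> + W)%VS).
  move=> v /memv_addP [v1 /vlineP [c ->] [v2 v2W ->]].
  by apply: QD => //; exact: WQ.
have sW : (W <= <[u]> + W)%VS by exact: addvSr.
have: (\dim W < \dim (<[u]> + W))%N.
  rewrite ltn_neqAle dimvS // andbT; apply/negP => /eqP E.
  have := dimv_leqif_eq sW; move=> [_]; rewrite E eqxx => /esym /eqP E2.
  by case/negP: uW; rewrite E2; apply: (subvP (addvSl _ _)); exact: memv_line.
have := dimvS (subvf (<[u]> + W)%VS); lia.
Qed.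

Lemma linear_hom (U V : vectType K) (f : U -> V) :
  linear f -> exists g : 'Hom(U, V), forall x, g x = f x.
Proof.
move=> lf; pose F : {linear U -> V} := HB.pack f (GRing.isLinear.Build K U V _ f lf).
by exists (linfun F) => x; rewrite lfunE.
Qed.

(** Both sides are the rank of the Gram matrix [B], once as row rank and once as column rank. *)
Lemma dim_left_right_kernel (U V : vectType K) (b : U -> V -> K)
    (LU : {vspace U}) (LV : {vspace V}) :
  (forall v c u1 u2, b (c *: u1 + u2) v = c * b u1 v + b u2 v) ->
  (forall u c v1 v2, b u (c *: v1 + v2) = c * b u v1 + b u v2) ->
  (forall u, u \in LU <-> forall v, b u v = 0) ->
  (forall v, v \in LV <-> forall u, b u v = 0) ->
  (\dim {:U} - \dim LU = \dim {:V} - \dim LV)%N.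
Proof.
move=> bl br LUP LVP.
pose B : 'M[K]_(dim U, dim V) :=
  \matrix_(i, j) b (r2v (delta_mx 0 i)) (r2v (delta_mx 0 j)).
have b0l v : b 0 v = 0.
  by have := bl v 1 0 0; rewrite scaler0 addr0 mul1r => /esym/(canRL (addrK _)); rewrite subrr.
have b0r u : b u 0 = 0.
  by have := br u 1 0 0; rewrite scaler0 addr0 mul1r => /esym/(canRL (addrK _)); rewrite subrr.
have bsl (I : finType) (F : I -> U) (c : I -> K) v :
    b (\sum_i c i *: F i) v = \sum_i c i * b (F i) v.
  apply: (big_ind2 (fun x y => b x v = y)) => // [x1 x2 y1 y2 E1 E2|i _].
    by have := bl v 1 x1 y1; rewrite scale1r mul1r E1 E2.
  by have := bl v (c i) (F i) 0; rewrite !addr0 b0l addr0.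
have bsr (I : finType) (F : I -> V) (c : I -> K) u :
    b u (\sum_i c i *: F i) = \sum_i c i * b u (F i).
  apply: (big_ind2 (fun x y => b u x = y)) => // [x1 x2 y1 y2 E1 E2|i _].
    by have := br u 1 x1 y1; rewrite scale1r mul1r E1 E2.
  by have := br u (c i) (F i) 0; rewrite !addr0 b0r addr0.
have xE (W : vectType K) (w : W) : w = \sum_j v2r w 0 j *: r2v (delta_mx 0 j).
  apply: (can_inj v2rK); rewrite linear_sum [LHS]row_sum_delta /=.
  by apply: eq_bigr => j _; rewrite linearZ /= r2vK.
have bE u v : b u v = (v2r u *m B *m (v2r v)^T) 0 0.
  rewrite {1}[u]xE bsl mxE.
  transitivity (\sum_i v2r u 0 i * \sum_j v2r v 0 j * B i j).
    by apply: eq_bigr => i _; rewrite {1}[v]xE bsr; congr (_ * _);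
       apply: eq_bigr => j _; rewrite mxE.
  under eq_bigr do rewrite mulr_sumr.
  rewrite exchange_big /=; apply: eq_bigr => j _.
  rewrite !mxE mulr_suml; apply: eq_bigr => i _; rewrite !mxE.
  by rewrite mulrCA mulrC.
have LUE : LU = mx2vs (kermx B).
  apply/vspaceP => u; apply/idP/idP.
    move=> /LUP bu; rewrite -[u]v2rK memvE /subsetv /vline !r2vK.
    rewrite !mx2vsK sub_kermx; apply/eqP/matrixP => i j; rewrite ord1 [RHS]mxE.
    have := bu (r2v (delta_mx 0 j)); rewrite bE r2vK.
    by rewrite trmx_delta -colE mxE.
  rewrite memvE /subsetv /vline !mx2vsK sub_kermx => /eqP E.
  by apply/LUP => v; rewrite bE E mul0mx mxE.
have LVE : LV = mx2vs (kermx B^T).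
  have bE' u v : b u v = (v2r v *m B^T *m (v2r u)^T) 0 0.
    by rewrite bE -[in RHS](trmxK (v2r v)) -!trmx_mul mulmxA [RHS]mxE.
  apply/vspaceP => v; apply/idP/idP.
    move=> /LVP bu; rewrite -[v]v2rK memvE /subsetv /vline !r2vK.
    rewrite !mx2vsK sub_kermx; apply/eqP/matrixP => i j; rewrite ord1 [RHS]mxE.
    have := bu (r2v (delta_mx 0 j)); rewrite bE' r2vK.
    by rewrite trmx_delta -colE mxE.
  rewrite memvE /subsetv /vline !mx2vsK sub_kermx => /eqP E.
  by apply/LVP => u; rewrite bE' E mul0mx mxE.
rewrite LUE LVE !dimvf /dimv !mx2vsK !mxrank_ker mxrank_tr.
have := rank_leq_row B; have := rank_leq_col B; lia.
Qed.

(** Coefficients are functions on all of [L] that vanish off [A], so that the cells of a staircase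
    can index vectors directly. *)
Lemma dim_span_indep (V : vectType K) (L : finType) (F : L -> V) (A : pred L) :
  (forall c : L -> K, (forall l, l \notin A -> c l = 0) ->
     \sum_l c l *: F l = 0 -> forall l, c l = 0) ->
  \dim <<[seq F l | l <- enum A]>> = #|A|.
Proof.
move=> indep; have E : size [seq F l | l <- enum A] = #|A| by rewrite size_map -cardE.
suff /eqP -> : free [seq F l | l <- enum A] by [].
apply/(@freeP _ _ _ (in_tuple [seq F l | l <- enum A])) => k Hk i.
move: k Hk i; rewrite /= E => k Hk i.
pose c l := \sum_(j < #|A|) if enum_val j == l then k j else 0.
have <- : c (enum_val i) = k i.
  rewrite /c (bigD1 i) //= eqxx big1 ?addr0 // => l li.
  by rewrite (inj_eq enum_val_inj) (negPf li).
apply: indep => [l lA|].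
  rewrite /c big1 // => a _; case: eqP => // El.
  by move: lA; rewrite -El (enum_valP a).
rewrite -[RHS]Hk.
transitivity (\sum_l \sum_(a < #|A|) (if enum_val a == l then k a else 0) *: F l).
  by apply: eq_bigr => l _; rewrite /c scaler_suml.
rewrite exchange_big; apply: eq_bigr => a _ /=.
rewrite (bigD1 (enum_val a)) //= eqxx big1 ?addr0 => [|l /negPf la]; last first.
  by rewrite eq_sym la scale0r.
rewrite (nth_map (enum_val a)) -?cardE //; congr (_ *: F _).
by rewrite /enum_val; apply: set_nth_default; rewrite -cardE.
Qed.

End LinearAlgebra.

(** * Homogeneous ideals and their graded pieces *)

Section Ideals.
Variables (K : fieldType) (n : nat).
Local Notation P := {mpoly K[n]}.
Implicit Type I : P -> Prop.

Lemma ideal_subspace I : is_ideal I -> is_subspace I.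
Proof.
move=> [I0 ID IM]; split=> // c u v Iu Iv; apply: ID => //.
by rewrite -mul_mpolyC; apply: IM.
Qed.

Lemma idealZ I c p : is_ideal I -> I p -> I (c *: p).
Proof. by move=> [_ _ IM] Ip; rewrite -mul_mpolyC; apply: IM. Qed.

Lemma idealMl I p r : is_ideal I -> I p -> I (p * r).
Proof. by move=> [_ _ IM] Ip; rewrite mulrC; apply: IM. Qed.

Lemma idealN I p : is_ideal I -> I p -> I (- p).
Proof. by move=> iI Ip; rewrite -scaleN1r; apply: idealZ. Qed.

Lemma idealB I p q : is_ideal I -> I p -> I q -> I (p - q).
Proof. by move=> iI Ip Iq; have [_ ID _] := iI; apply: ID => //; apply: idealN. Qed.

Lemma ideal_sum I (T : eqType) (r : seq T) (A : pred T) (F : T -> P) :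
  is_ideal I -> (forall i, i \in r -> A i -> I (F i)) -> I (\sum_(i <- r | A i) F i).
Proof.
move=> [I0 ID _] IF; rewrite big_seq_cond.
by apply: big_ind => // i /andP[ir Ai]; apply: IF.
Qed.

Lemma pihomog_mulX d (p : P) m : pihomog mdeg (d + mdeg m) (p * 'X_[m]) = pihomog mdeg d p * 'X_[m].
Proof.
rewrite [in LHS](mpolyE p) mulr_suml linear_sum pihomogE mulr_suml [RHS]big_mkcond.
apply: eq_bigr => u _; rewrite -scalerAl -mpolyXD linearZ /= pihomogX /= mdegD eqn_add2r.
by case: eqP => _; rewrite ?scaler0 // mpolyXD scalerAl.
Qed.

Lemma pihomog_mulX_lt d (p : P) m : (d < mdeg m)%N -> pihomog mdeg d (p * 'X_[m]) = 0.
Proof.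
move=> dm; rewrite [in LHS](mpolyE p) mulr_suml linear_sum big1 // => u _.
rewrite -scalerAl -mpolyXD linearZ /= pihomogX /= mdegD.
by case: eqP => [E|_]; [move: dm; lia | rewrite scaler0].
Qed.

Lemma pihomog_homogMl d e (p q : P) :
  p \is d.-homog -> pihomog mdeg (d + e) (p * q) = p * pihomog mdeg e q.
Proof.
move=> hp; rewrite [in LHS](mpolyE q) mulr_sumr linear_sum pihomogE mulr_sumr [RHS]big_mkcond.
apply: eq_bigr => m _; rewrite -scalerAr linearZ /=.
case: eqP => [E|/eqP E].
  by rewrite -E pihomog_mulX pihomog_dE // scalerAr.
rewrite (@pihomog_ne0 _ _ mdeg (d + mdeg m)) ?scaler0 // ?eqn_add2l //.
by apply: dhomogM => //; rewrite dhomogX.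
Qed.

Lemma mpoly_monomial_ind (Q : P -> Prop) :
  (forall c p q, Q p -> Q q -> Q (c *: p + q)) -> Q 0 ->
  (forall m, Q 'X_[m]) -> forall p, Q p.
Proof.
move=> QD Q0 QX p; rewrite (mpolyE p).
apply: (big_ind Q) => // [x y Qx Qy|m _]; first by rewrite -[x]scale1r; apply: QD.
by rewrite -[_ *: _]addr0; apply: QD.
Qed.

Lemma homog_monomial_ind d (Q : P -> Prop) :
  (forall c p q, Q p -> Q q -> Q (c *: p + q)) -> Q 0 ->
  (forall m, mdeg m = d -> Q 'X_[m]) -> forall p, p \is d.-homog -> Q p.
Proof.
move=> QD Q0 QX p /dhomogP hp; rewrite (mpolyE p) big_seq.
apply: (big_ind Q) => // [x y Qx Qy|m mp]; first by rewrite -[x]scale1r; apply: QD.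
by rewrite -[_ *: _]addr0; apply: QD => //; apply: QX; apply: hp.
Qed.

Lemma mdeg_gt0_split (m : 'X_{1..n}) : (0 < mdeg m)%N ->
  exists k m', m = (U_(k) + m')%MM /\ mdeg m = (mdeg m').+1.
Proof.
move=> m0; case: (pickP (fun k => m k != 0%N)) => [k mk|mz]; last first.
  by move: m0; rewrite mdegE big1 // => i _; apply/eqP; rewrite -[_ == _]negbK mz.
have E : m = (U_(k) + (m - U_(k)))%MM by rewrite addmC submK // lep1mP.
by exists k, (m - U_(k))%MM; split=> //; rewrite [in LHS]E mdegD mdeg1.
Qed.

Lemma homogS_ind d (Q : P -> Prop) :
  (forall c p q, Q p -> Q q -> Q (c *: p + q)) -> Q 0 ->
  (forall k q, q \is d.-homog -> Q ('X_k * q)) -> forall p, p \is d.+1.-homog -> Q p.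
Proof.
move=> QD Q0 QX; apply: homog_monomial_ind => // m dm.
have [|k [m' [Em dm']]] := @mdeg_gt0_split m; first by rewrite dm.
rewrite Em mpolyXD; apply: QX; rewrite dhomogX; apply/eqP => /=; lia.
Qed.

Lemma dim_mod_inj I (Q : P -> Prop) N1 N2 : dim_mod I Q N1 -> dim_mod I Q N2 -> N1 = N2.
Proof.
move=> [[s1 [E1 Q1 i1]] m1] [[s2 [E2 Q2 i2]] m2].
by apply/eqP; rewrite eqn_leq -{1}E1 -{2}E2 m2 // m1.
Qed.

End Ideals.

(** * Graded pieces as finite-dimensional vector spaces *)

Section Pieces.
Variables (K : fieldType) (n : nat).
Local Notation P := {mpoly K[n.+1]}.
Local Notation R := (dhomog n.+1 K).
Implicit Types (I Q : P -> Prop) (i d : nat).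

(** [Q] is an arbitrary predicate, so the space is picked by [epsilon]; the value is meaningful when
    [Q] is a subspace. *)
Definition piece i Q : {vspace R i} :=
  epsilon (inhabits 0%VS) (fun W : {vspace R i} => forall u, u \in W <-> Q u).

Lemma pieceP i Q (u : R i) : is_subspace Q -> (u \in piece i Q <-> Q u).
Proof.
move=> [Q0 QD]; apply: (epsilon_spec (inhabits _)
  (fun W : {vspace R i} => forall u, u \in W <-> Q u)).
apply: (subspace_vspace (Q := fun u : R i => Q u)); split=> // c u' v' Qu Qv.
exact: QD.
Qed.

Definition codim i Q := (\dim {:R i} - \dim (piece i Q))%N.

(** A basis of a complement of the piece attains the bound. Conversely, independence modulo [I]
    makes the span of a family meet the piece only in 0. *)
Lemma dim_mod_codim i I : is_subspace I ->
  dim_mod I (fun p => p \is i.-homog) (codim i I).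
Proof.
move=> sI; split.
  pose X := vbasis (piece i I)^C%VS.
  exists [seq mpoly_of_dhomog u | u <- X]; split.
  - by rewrite size_map size_tuple dimv_compl.
  - by move=> q /mapP [u _ ->]; apply: dhomog_is_dhomog.
  move=> c; rewrite /= => Ic.
  have E : size [seq mpoly_of_dhomog u | u <- X] = \dim (piece i I)^C%VS.
    by rewrite size_map size_tuple.
  move: c Ic; rewrite E => c Ic k.
  have /freeP fr : free X := basis_free (vbasisP _).
  have Hs : \sum_(k < \dim (piece i I)^C) c k *: X`_k \in (piece i I :&: (piece i I)^C)%VS.
    rewrite memv_cap; apply/andP; split.
      apply/(pieceP _ sI); rewrite linear_sum /=.
      suff -> : \sum_(i0 < \dim (piece i I)^C) mpoly_of_dhomog (c i0 *: X`_i0) =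
           \sum_(k < \dim (piece i I)^C) c k *: [seq mpoly_of_dhomog u | u <- X]`_k by [].
      by apply: eq_bigr => l _; rewrite linearZ /= (nth_map 0) ?size_tuple.
    by apply: memv_suml => l _; apply: memvZ; apply: vbasis_mem; rewrite mem_nth ?size_tuple.
  by move: Hs; rewrite capv_compl memv0 => /eqP /fr; apply.
move=> s hs ind.
pose X := [seq (indhomog i u : R i) | u <- s].
have EX u : u \in s -> (indhomog i u : P) = u.
  by move=> us; rewrite /indhomog val_insubd hs.
have fr : free X.
  apply/(@freeP _ _ _ (in_tuple X)) => k Hk.
  have E : size X = size s by rewrite size_map.
  move: k Hk; rewrite /= E => k Hk; apply: ind.
  suff -> : \sum_(k0 < size s) k k0 *: s`_k0 = (0 : R i) by case: sI.
  rewrite -Hk linear_sum; apply: eq_bigr => l _.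
  by rewrite linearZ /= (nth_map 0) // EX // mem_nth.
have dj : (<<X>> :&: piece i I = 0)%VS.
  apply/eqP; rewrite -subv0; apply/subvP => u; rewrite memv_cap => /andP[uX uI].
  have /pieceP := uI; move=> /(_ sI) Iu.
  have [c uE] : exists c : 'I_(size X) -> K, u = \sum_(k < size X) c k *: X`_k.
    by exists (fun k => coord (in_tuple X) k u); exact: (coord_span (X := in_tuple X) uX).
  have E : size X = size s by rewrite size_map.
  move: c uE; rewrite E => c uE.
  suff c0 : forall k, c k = 0.
    by rewrite memv0 uE big1 // => l _; rewrite c0 scale0r.
  apply: ind; suff <- : (u : P) = \sum_(k < size s) c k *: s`_k by [].
  rewrite uE linear_sum; apply: eq_bigr => l _.
  by rewrite linearZ /= (nth_map 0) // EX // mem_nth.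
move: fr; rewrite /free size_map => /eqP fr.
rewrite /codim leq_subRL ?dimvS ?subvf // addnC -fr -(dimv_disjoint_sum dj).
by rewrite dimvS ?subvf.
Qed.

End Pieces.

(** * Ideals defined by a dual functional *)

Section DualFunctional.
Variables (K : fieldType) (n : nat).
Local Notation P := {mpoly K[n]}.

Definition is_linear_form (phi : P -> K) : Prop :=
  forall c p q, phi (c *: p + q) = c * phi p + phi q.

Lemma linear_form0 phi : is_linear_form phi -> phi 0 = 0.
Proof.
move=> lphi; have := lphi 1 0 0; rewrite scaler0 addr0 mul1r.
by move=> /esym/(canRL (addrK _)); rewrite subrr.
Qed.

Definition dual_generator (phi : P -> K) (j : nat) (I : P -> Prop) : Prop :=
  forall i p, (i <= j)%N -> p \is i.-homog ->
    (I p <-> forall q, q \is (j - i).-homog -> phi (p * q) = 0).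

(** The ideal whose Macaulay inverse system is generated by [phi]; testing only the degree [j] part
    makes it homogeneous. *)
Definition annihilator (phi : P -> K) (j : nat) (p : P) : Prop :=
  forall q, phi (pihomog mdeg j (p * q)) = 0.

Variables (phi : P -> K) (j : nat).
Hypothesis lphi : is_linear_form phi.
Local Notation J := (annihilator phi j).

Let phi0 : phi 0 = 0 := linear_form0 lphi.

Lemma annihilator_ideal : is_ideal J.
Proof.
split=> [q|p q Jp Jq r|r p Jp q].
- by rewrite mul0r linear0.
- by rewrite mulrDl linearD /= -[pihomog _ _ _]scale1r lphi Jp Jq mulr0 addr0.
- by rewrite -mulrA mulrCA Jp.
Qed.

Lemma annihilatorP p :
  (forall m, phi (pihomog mdeg j (p * 'X_[m])) = 0) -> J p.
Proof.
move=> H q; elim/mpoly_monomial_ind: q => [c q r Hq Hr||m]; last exact: H.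
  by rewrite mulrDr linearD /= -scalerAr linearZ /= lphi Hq Hr mulr0 addr0.
by rewrite mulr0 linear0.
Qed.

Lemma annihilator_homogeneous : is_homogeneous_ideal J.
Proof.
split=> [|p d Jp]; first exact: annihilator_ideal.
apply: annihilatorP => m; case: (leqP (mdeg m) j) => mj; last by rewrite pihomog_mulX_lt.
have E : j = (j - mdeg m + mdeg m)%N by rewrite subnK.
have := Jp 'X_[m]; rewrite E !pihomog_mulX => Jm.
case: (eqVneq d (j - mdeg m)%N) => [->|ne]; first by rewrite pihomog_id.
by rewrite (@pihomog_ne0 _ _ mdeg d) ?mul0r // pihomogP.
Qed.

Lemma annihilator_high i p : (j < i)%N -> p \is i.-homog -> J p.
Proof.
move=> ji hp; apply: annihilatorP => m.
case: (leqP (mdeg m) j) => mj; last by rewrite pihomog_mulX_lt.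
rewrite -(subnK mj) pihomog_mulX (@pihomog_ne0 _ _ mdeg i) ?mul0r //.
by apply/eqP; lia.
Qed.

Lemma annihilator_dual : dual_generator phi j J.
Proof.
move=> i p ij hp; split=> [Jp q hq|H q].
  have := Jp q; rewrite pihomog_dE // -(subnKC ij).
  exact: dhomogM.
by rewrite -(subnKC ij) pihomog_homogMl // H // pihomogP.
Qed.

Lemma annihilator_gorenstein g : g \is j.-homog -> phi g <> 0 ->
  graded_artinian_gorenstein J.
Proof.
move=> hg /eqP phig; split; first split.
- exact: annihilator_homogeneous.
- by exists j.+1 => p; apply: annihilator_high.
have [J0 JD JM] := annihilator_ideal.
have gN c : J (c *: g) -> c = 0.
  move=> /(_ 1); rewrite mulr1 linearZ /= pihomog_dE // -[_ *: _]addr0 lphi phi0 addr0.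
  by move=> /eqP; rewrite mulf_eq0 (negPf phig) orbF => /eqP.
split.
  exists [:: g]; split=> [//|q|c].
    rewrite inE => /eqP -> k; apply: (@annihilator_high j.+1) => //.
    by rewrite -addn1; apply: dhomogM => //; rewrite dhomogX /= mdeg1.
  by rewrite big_ord1 /= => /gN c0 k; rewrite ord1.
have sE f : socle_pred J f -> exists c, J (f - c *: g).
  (* The multiple of [g] makes the difference pair to 0 with constants. Against a monomial of
     positive degree, [f] pairs to 0 as a socle element and [g] because it already has degree
     [j]. *)
  move=> sf; exists (phi (pihomog mdeg j f) / phi g); apply: annihilatorP => m.
  case: (posnP (mdeg m)) => [/eqP|m0].
    rewrite mdeg_eq0 => /eqP ->; rewrite mpolyX0 mulr1 linearB linearZ /=.
    rewrite (pihomog_dE hg) addrC -scaleNr lphi mulNr divfK //.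
    by rewrite addNr.
  have [k [m' [Em _]]] := mdeg_gt0_split m0.
  have -> : (f - (phi (pihomog mdeg j f) / phi g) *: g) * 'X_[m] =
      - (phi (pihomog mdeg j f) / phi g) *: (g * 'X_[m]) + f * 'X_k * 'X_[m'].
    by rewrite mulrBl addrC scaleNr -scalerAl -mulrA -mpolyXD -Em.
  have Z : pihomog mdeg j (g * 'X_[m]) = 0.
    apply: (@pihomog_ne0 _ _ mdeg (j + mdeg m)%N); last by apply: dhomogM => //; rewrite dhomogX.
    by rewrite -[X in _ != X]addn0 eqn_add2l -lt0n.
  by rewrite linearD /= linearZ /= lphi sf addr0 Z phi0 mulr0.
case=> [|u [|v s]] // Qs ind.
have [|a Ja] := sE u; first by apply: Qs; rewrite inE eqxx.
have [|b Jb] := sE v; first by apply: Qs; rewrite !inE eqxx orbT.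
have [b0|b0] := eqVneq b 0.
  move: Jb; rewrite b0 scale0r subr0 => Jv.
  have := ind (fun k => if k == lift ord0 ord0 then 1 else 0) _ (lift ord0 ord0).
  rewrite eqxx => /(_ _)/eqP; rewrite oner_eq0; apply.
  rewrite !big_ord_recl big1 /= => [|k _]; last by rewrite scale0r.
  by rewrite scale0r scale1r add0r addr0.
(* Modulo the ideal [u] is [a g] and [v] is [b g], so [b u - a v] is a relation, nontrivial because
   [b] is nonzero. *)
have := ind (fun k => if k == ord0 then b else if k == lift ord0 ord0 then - a else 0) _ ord0.
rewrite eqxx => /(_ _)/eqP; rewrite (negPf b0); apply.
rewrite !big_ord_recl big1 /= => [|k _]; last by rewrite scale0r.
have -> : b *: u + (- a *: v + 0) = b *: (u - a *: g) + - a *: (v - b *: g).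
  rewrite addr0 !scalerBr !scalerA mulNr (scaleNr (a * b)) opprK addrACA [b * a]mulrC.
  by rewrite addNr addr0.
have iJ := annihilator_ideal.
exact: JD (idealZ _ iJ Ja) (idealZ _ iJ Jb).
Qed.

End DualFunctional.

(** The left and right kernels of the form [phi (g * u * v)] are pieces of the colon ideal (I : g).
    A linear form [g] gives the symmetry of the ranks of multiplication by [g], and [g = 1] that of
    the Hilbert function. *)
Lemma codim_colon_sym (K : fieldType) (n : nat) (phi : {mpoly K[n.+1]} -> K) j I e g i :
  is_linear_form phi -> is_ideal I -> dual_generator phi j I ->
  g \is e.-homog -> (i + e <= j)%N ->
  codim i (fun p => I (g * p)) = codim (j - e - i) (fun p => I (g * p)).
Proof.
move=> lphi iI dI hg ie.
have sI : is_subspace (fun p => I (g * p)).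
  have [I0 ID] := ideal_subspace iI.
  by split=> [|c u v Iu Iv]; [rewrite mulr0 | rewrite mulrDr -scalerAr; apply: ID].
have mem a b : (a + b + e = j)%N -> forall u : dhomog n.+1 K a,
    u \in piece a (fun p => I (g * p)) <->
    forall v : dhomog n.+1 K b, phi (g * u * v) = 0.
  move=> abe u.
  have hgu : g * (u : {mpoly K[n.+1]}) \is (e + a).-homog.
    exact: dhomogM hg (dhomog_is_dhomog u).
  have le : (e + a <= j)%N by lia.
  have Eb : b = (j - (e + a))%N by lia.
  split=> [/pieceP - /(_ sI) /(dI _ _ le hgu) H v|H].
    by apply: H; rewrite -Eb; exact: dhomog_is_dhomog.
  apply/pieceP => //; apply/(dI _ _ le hgu) => q; rewrite -Eb => hq.
  exact: (H (DHomog hq)).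
apply: (@dim_left_right_kernel _ _ _
  (fun (u : dhomog n.+1 K i) (v : dhomog n.+1 K (j - e - i)) => phi (g * u * v))).
- by move=> v c u1 u2 /=; rewrite mulrDr mulrDl -scalerAr -scalerAl lphi.
- by move=> u c v1 v2 /=; rewrite mulrDr -scalerAr lphi.
- by apply: mem; lia.
move=> v; split.
  move=> /mem - /(_ i) H u; rewrite mulrAC; apply: H; lia.
move=> H; apply/(mem _ i); first by lia.
by move=> u; rewrite mulrAC.
Qed.

Lemma codim_sym (K : fieldType) (n : nat) (phi : {mpoly K[n.+1]} -> K) j I i :
  is_linear_form phi -> is_ideal I -> dual_generator phi j I -> (i <= j)%N ->
  codim i I = codim (j - i) I.
Proof.
move=> lphi iI dI ij.
have E a : codim a (fun p => I (1 * p)) = codim a I.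
  by congr codim; apply: functional_extensionality => p; rewrite mul1r.
have := @codim_colon_sym K n phi j I 0 1 i lphi iI dI (dhomog1 _ _).
by rewrite addn0 subn0 !E; apply.
Qed.

(** * Gorenstein algebras from points below a staircase *)

(** Euclid's argument: a root of [\prod_(a <- s) ('X - a%:P) * 'X + 1] lies outside [s]. The factor
    ['X] keeps the polynomial nonconstant when [s] is empty. *)
Lemma closed_field_uniq_seq (K : closedFieldType) N :
  exists s : seq K, uniq s /\ size s = N.
Proof.
elim: N => [|N [s [us <-]]]; first by exists [::].
have [|x] := @closed_rootP K (\prod_(a <- s) ('X - a%:P) * 'X + 1) _.
  have [->|s0] := eqVneq s [::].
    by rewrite big_nil mul1r size_polyDl ?size_polyX ?size_poly1.
  have sz : size (\prod_(a <- s) ('X - a%:P) * 'X : {poly K}) = (size s).+2.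
    rewrite size_mulX ?size_prod_XsubC // monic_neq0 //.
    exact: monic_prod_XsubC.
  by rewrite size_polyDl sz ?size_poly1.
move=> rx; exists (x :: s); split=> //=; rewrite us andbT; apply/negP => xs.
move: rx; rewrite /root !hornerE; have := root_prod_XsubC s x.
by rewrite xs /root => /eqP ->; rewrite mul0r add0r oner_eq0.
Qed.

Definition stair (T : nat -> nat) (d a b : nat) : bool :=
  (a + b <= d)%N && (a < T (a + b))%N.

(** As [T d <= d.+1], the antidiagonal of degree [d] contains exactly [T d] cells. *)
Lemma card_stair T s i : (i <= s)%N -> (forall d, (d <= s)%N -> (T d <= d.+1)%N) ->
  #|[pred x : 'I_s.+1 * 'I_s.+1 | stair T i x.1 x.2]| = (\sum_(k < i.+1) T k)%N.
Proof.
move=> is_ Td.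
have level d : (d <= s)%N ->
    #|[pred x : 'I_s.+1 * 'I_s.+1 | (x.1 + x.2 == d)%N && (x.1 < T d)%N]| = T d.
  move=> ds; have Tds := Td d ds.
  pose f (k : 'I_(T d)) : 'I_s.+1 * 'I_s.+1 := (inord k, inord (d - k)).
  have kd (k : 'I_(T d)) : (k <= d)%N by have := ltn_ord k; lia.
  have f1 k : (f k).1 = k :> nat by rewrite inordK //; have := kd k; lia.
  have f2 k : (f k).2 = (d - k)%N :> nat by rewrite inordK //; have := kd k; lia.
  have fi : injective f.
    by move=> k l E; apply/val_inj; rewrite /= -f1 E f1.
  rewrite -[RHS]card_ord -(card_image fi); apply: eq_card => -[x1 x2]; rewrite !inE /=.
  apply/andP/imageP => [[/eqP x12 xT]|[k _ E]].
    exists (Ordinal xT) => //; apply/eqP; rewrite xpair_eqE.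
    by apply/andP; split; apply/eqP/val_inj; [rewrite [RHS]f1 | rewrite [RHS]f2 /= -x12 addKn].
  have [-> ->] : x1 = (f k).1 /\ x2 = (f k).2 by rewrite -E.
  rewrite f1 f2; split; last exact: ltn_ord.
  by rewrite subnKC.
elim: i is_ => [|i IHi] is_.
  rewrite big_ord1 -(level 0%N) //; apply: eq_card => x; rewrite !inE /stair /=.
  by rewrite leqn0; case: eqP => // ->.
rewrite big_ord_recr /= -IHi 1?ltnW // -(level i.+1) //.
rewrite -(cardID [pred x : 'I_s.+1 * 'I_s.+1 | (x.1 + x.2 <= i)%N]).
congr (_ + _)%N; apply: eq_card => x; rewrite !inE /stair /=.
  case: (leqP (x.1 + x.2) i) => h; rewrite ?andbF ?andbT //=.
  by rewrite (leq_trans h).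
rewrite -ltnNge; have [E|ne] := eqVneq (x.1 + x.2)%N i.+1.
  by rewrite E !leqnn.
by rewrite andbA -eqn_leq eq_sym (negPf ne).
Qed.

(** Induction through x = (x - al k) + al k: the first summand raises the index ([c1]), the second
    keeps it ([c2]). *)
Lemma newton_expansion (K : fieldType) (al : nat -> K) a :
  exists c : nat -> K, forall x, x ^+ a = \sum_(k < a.+1) c k * \prod_(l < k) (x - al l).
Proof.
elim: a => [|a [c IH]].
  by exists (fun=> 1) => x; rewrite big_ord1 big_ord0 mulr1.
pose c1 k := if k is k'.+1 then c k' else 0.
pose c2 k := if (k < a.+1)%N then c k * al k else 0.
exists (fun k => c1 k + c2 k) => x.
rewrite exprS IH mulr_sumr.
under [RHS]eq_bigr do rewrite mulrDl.
rewrite big_split /= [X in _ = X + _]big_ord_recl [X in _ = _ + X]big_ord_recr /=.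
rewrite /c2 ltnn !mul0r add0r addr0 -big_split; apply: eq_bigr => k _ /=.
by rewrite ltn_ord big_ord_recr /=; ring.
Qed.

(** * Evaluation at grid points indexed by a staircase *)

Section Points.
Variables (K : closedFieldType) (s : nat) (T : nat -> nat) (al : nat -> K).
Hypothesis Td : forall d, (d <= s)%N -> (T d <= d.+1)%N.
Hypothesis TS : forall d, (d < s)%N -> T d = d.+1 \/ (T d.+1 <= T d)%N.
Hypothesis al_inj : forall k l, (k <= s)%N -> (l <= s)%N -> al k = al l -> k = l.

Local Notation L := ('I_s.+1 * 'I_s.+1)%type.
Local Notation P := {mpoly K[3]}.
Local Notation Lam := [pred x : L | stair T s x.1 x.2].

(** A unit step down leads to the previous antidiagonal, which either is full or has a bound [T] at
    least as large as the one just left. *)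
Lemma stair_down a b a' b' : stair T s a b -> (a' <= a)%N -> (b' <= b)%N -> stair T s a' b'.
Proof.
have step d x : (d < s)%N -> (x < T d.+1)%N -> (x.-1 < T d)%N /\ ((x <= d)%N -> (x < T d)%N).
  by move=> ds xT; have := Td ds; case: (TS ds); lia.
have decb : forall k a b, stair T s a (b + k) -> stair T s a b.
  elim=> [|k IHk] x y; first by rewrite addn0.
  rewrite addnS => /andP[h1 h2]; apply: IHk; move: h1 h2; rewrite addnS => h1 h2.
  by have [_ st] := step _ _ h1 h2; rewrite /stair ltnW //= st // leq_addr.
have deca : forall k a b, stair T s (a + k) b -> stair T s a b.
  elim=> [|k IHk] x y; first by rewrite addn0.
  rewrite addnS => /andP[h1 h2]; apply: IHk; move: h1 h2; rewrite addSn => h1 h2.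
  by have [st _] := step _ _ h1 h2; rewrite /stair ltnW.
move=> st aa bb; apply: (deca (a - a')%N); rewrite subnKC //.
by apply: (decb (b - b')%N); rewrite subnKC.
Qed.

Definition newton (a b : nat) (x : L) : K :=
  \prod_(l < a) (al x.1 - al l) * \prod_(l < b) (al x.2 - al l).

Lemma newton1_neq0 a (k : 'I_s.+1) : (\prod_(l < a) (al k - al l) != 0) = (a <= k)%N.
Proof.
have ks : (k <= s)%N by rewrite -ltnS.
apply/idP/idP => [|ak].
  apply: contraNT; rewrite -ltnNge => ka.
  by apply/prodf_eq0; exists (Ordinal ka) => //; rewrite subrr.
apply/prodf_neq0 => l _; rewrite subr_eq0; apply/eqP => /al_inj E.
have la := ltn_ord l.
have ls : (l <= s)%N by lia.
by have := E ks ls; lia.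
Qed.

(** Newton products are triangular for the product order on cells; this drives the next two
    inductions. *)
Lemma newton_neq0 a b x : (newton a b x != 0) = (a <= x.1)%N && (b <= x.2)%N.
Proof. by rewrite /newton mulf_eq0 negb_or !newton1_neq0. Qed.

Definition pt (x : L) (k : 'I_3) : K := nth 0 [:: al x.1; al x.2; 1] k.

(** The power of the last variable adjusts the degree without changing values at the points [pt x],
    whose last coordinate is 1. *)
Definition newton_form (a b c : nat) : P :=
  \prod_(l < a) ('X_(inord 0) - al l *: 'X_(inord 2)) *
  \prod_(l < b) ('X_(inord 1) - al l *: 'X_(inord 2)) * 'X_(inord 2) ^+ c.

Lemma newton_form_homog a b c : newton_form a b c \is (a + b + c).-homog.
Proof.
have hX k : ('X_k : P) \is 1.-homog by rewrite dhomogX /= mdeg1.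
have hp k m : \prod_(l < m) ('X_k - al l *: 'X_(inord 2) : P) \is m.-homog.
  elim: m => [|m IHm]; first by rewrite big_ord0 dhomog1.
  by rewrite big_ord_recr /= -[m.+1]addn1; apply: dhomogM => //; apply: rpredB => //; apply: rpredZ.
apply: dhomogM; first exact: dhomogM.
by rewrite -[c in c.-homog]mul1n; apply: dhomogMn.
Qed.

Lemma newton_form_eval a b c x : (newton_form a b c).@[pt x] = newton a b x.
Proof.
rewrite /newton_form !rmorphM rmorphXn !rmorph_prod /= mevalXU /pt inordK //= expr1n mulr1.
by congr (_ * _); apply: eq_bigr => l _; rewrite mevalB mevalZ !mevalXU !inordK //= mulr1.
Qed.

(** Upward induction on [x.1 + x.2]: at the point of [x], only products indexed by cells below [x]
    contribute. *)
Lemma newton_indep (A : pred L) (c : L -> K) : (forall x, A x -> Lam x) ->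
  (forall x, ~~ A x -> c x = 0) ->
  (forall x, Lam x -> \sum_y c y * newton y.1 y.2 x = 0) -> forall x, c x = 0.
Proof.
move=> AL cA cE x; have [m] := ubnP (x.1 + x.2)%N; elim: m x => // m IH x xm.
case: (boolP (A x)) => [Ax|]; last exact: cA.
have := cE x (AL x Ax); rewrite (bigD1 x) //= big1 => [|y yx].
  rewrite addr0 => /eqP; rewrite mulf_eq0 (negPf (_ : newton _ _ _ != 0)) ?orbF => [/eqP|] //.
  by rewrite newton_neq0 !leqnn.
have [->|] := eqVneq (newton y.1 y.2 x) 0; first by rewrite mulr0.
rewrite newton_neq0 => /andP[h1 h2].
rewrite IH ?mul0r //.
case: (ltngtP y.1 x.1) h1 => // h1; case: (ltngtP y.2 x.2) h2 => // h2 _ _; try lia.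
case/eqP: yx; rewrite [x]surjective_pairing [y]surjective_pairing.
by congr pair; apply: val_inj.
Qed.

(** Downward induction: the product indexed by [x] only sees the points of cells above [x]. *)
Lemma newton_nondeg (p : L -> K) :
  (forall x, Lam x -> \sum_(y | Lam y) p y * newton x.1 x.2 y = 0) ->
  forall x, Lam x -> p x = 0.
Proof.
move=> pE x; have [m] := ubnP (s - (x.1 + x.2))%N; elim: m x => // m IH x xm Lx.
have := pE x Lx; rewrite (bigD1 x) //= big1 => [|y /andP[Ly yx]].
  rewrite addr0 => /eqP; rewrite mulf_eq0 (negPf (_ : newton _ _ _ != 0)) ?orbF => [/eqP|] //.
  by rewrite newton_neq0 !leqnn.
have [->|] := eqVneq (newton x.1 x.2 y) 0; first by rewrite mulr0.
rewrite newton_neq0 => /andP[h1 h2].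
rewrite IH ?mul0r //.
have /andP [Ly1 _] := Ly.
case: (ltngtP x.1 y.1) h1 => // h1; case: (ltngtP x.2 y.2) h2 => // h2 _ _; try lia.
case/eqP: yx; rewrite [x]surjective_pairing [y]surjective_pairing.
by congr pair; apply: val_inj.
Qed.

Definition points_form (f : P) : K := \sum_(x : L | Lam x) f.@[pt x].

Lemma points_form_linear : is_linear_form points_form.
Proof.
move=> c p q; rewrite /points_form mulr_sumr -big_split; apply: eq_bigr => x _.
by rewrite mevalD mevalZ.
Qed.

(** Since [i + s <= j], the complementary degree is at least [s], which leaves room for the Newton
    forms of all cells; these separate the points. *)
Lemma points_annihilatorP j i (p : P) : (i + s <= j)%N -> p \is i.-homog ->
  (annihilator points_form j p <-> forall x, Lam x -> p.@[pt x] = 0).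
Proof.
move=> isj hp; have ij : (i <= j)%N by lia.
have dI := @annihilator_dual _ _ points_form j i p ij hp.
split=> [/dI H|H].
  apply: newton_nondeg => x Lx.
  have /andP [xs _] := Lx.
  transitivity (points_form (p * newton_form x.1 x.2 (j - i - (x.1 + x.2)))).
    by apply: eq_bigr => y _; rewrite mevalM newton_form_eval.
  apply: H; rewrite (_ : (j - i = x.1 + x.2 + (j - i - (x.1 + x.2)))%N) 1?addKn; last by lia.
  exact: newton_form_homog.
apply/dI => q _; rewrite /points_form big1 // => x Lx.
by rewrite mevalM H // mul0r.
Qed.

Lemma points_codim j i : (i <= s)%N -> (i + s <= j)%N ->
  codim i (annihilator points_form j) = (\sum_(k < i.+1) T k)%N.
Proof.
move=> is_ isj.
pose ev (p : dhomog 3 K i) : {ffun L -> K^o} :=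
  [ffun x => if Lam x then (p : P).@[pt x] else 0].
have [|E EE] := @linear_hom K _ _ ev.
  move=> c p q; apply/ffunP => x; rewrite !ffunE; case: ifP => _; last by rewrite scaler0 addr0.
  by rewrite mevalD mevalZ.
have sI : is_subspace (annihilator points_form j).
  exact/ideal_subspace/annihilator_ideal/points_form_linear.
have -> : codim i (annihilator points_form j) = \dim (limg E).
  rewrite /codim -(limg_ker_dim E fullv) capfv.
  suff -> : piece i (annihilator points_form j) = lker E by rewrite addKn.
  apply/vspaceP => p; rewrite memv_ker; apply/idP/eqP.
    move=> /pieceP - /(_ sI) /(points_annihilatorP isj (dhomog_is_dhomog p)) H.
    by rewrite EE; apply/ffunP => x; rewrite !ffunE; case: ifP => // /H.
  move=> E0; apply/pieceP => //; apply/(points_annihilatorP isj (dhomog_is_dhomog p)) => x Lx.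
  by have /ffunP/(_ x) := E0; rewrite EE !ffunE Lx.
pose A := [pred x : L | stair T i x.1 x.2].
pose N (x : L) : {ffun L -> K^o} := [ffun y => if Lam y then newton x.1 x.2 y else 0].
have AL x : A x -> Lam x by rewrite /A /= /stair => /andP[h ->]; rewrite (leq_trans h).
rewrite -(card_stair is_ Td) -/A -(dim_span_indep (F := N)); last first.
  move=> c cA cE; apply: (newton_indep AL) => // x Lx.
  have /ffunP/(_ x) := cE; rewrite sum_ffunE [RHS]ffunE => E0; rewrite -[RHS]E0.
  by apply: eq_bigr => y _; rewrite !ffunE Lx.
congr (\dim _); apply/eqP; rewrite eqEsubv; apply/andP; split; last first.
  apply/span_subvP => v /mapP [x]; rewrite mem_enum => Ax ->.
  have hf : newton_form x.1 x.2 (i - (x.1 + x.2)) \is i.-homog.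
    have /andP [xi _] := Ax.
    by have := newton_form_homog x.1 x.2 (i - (x.1 + x.2)); rewrite subnKC.
  have -> : N x = E (DHomog hf).
    by rewrite EE; apply/ffunP => y; rewrite !ffunE newton_form_eval.
  exact: memv_img (memvf _).
apply/subvP => v /memv_imgP [p _ ->].
(* A product indexed outside the staircase vanishes at every point, because the staircase is closed
   downwards. *)
have memN a b : (a + b <= i)%N ->
    [ffun y : L => if Lam y then newton a b y else 0] \in <<[seq N x | x <- enum A]>>%VS.
  move=> abi; case: (boolP (stair T i a b)) => [sab|nsab].
    have ha : (a < s.+1)%N by lia.
    have hb : (b < s.+1)%N by lia.
    apply: memv_span; apply/mapP; exists (Ordinal ha, Ordinal hb) => //.
    by rewrite mem_enum.
  rewrite (_ : [ffun _ => _] = (0 : {ffun L -> K^o})); first exact: mem0v.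
  apply/ffunP => y; rewrite !ffunE.
  case: ifP => // Ly; apply/eqP; rewrite -[_ == _]negbK newton_neq0.
  apply: contra nsab => /andP [ay by_].
  have /andP [_ h] := stair_down Ly ay by_.
  by rewrite /stair abi.
rewrite EE /ev.
case: p => p hp /=; elim/homog_monomial_ind: hp => {p} [c p q Hp Hq||m dm].
- have -> : [ffun x => if Lam x then (c *: p + q).@[pt x] else 0] =
     c *: ([ffun x => if Lam x then p.@[pt x] else 0] : {ffun L -> K^o}) +
     [ffun x => if Lam x then q.@[pt x] else 0].
    by apply/ffunP => x; rewrite !ffunE; case: ifP => _; rewrite ?scaler0 ?addr0 // mevalD mevalZ.
  by apply: memvD => //; apply: memvZ.
- rewrite (_ : [ffun _ => _] = (0 : {ffun L -> K^o})); first exact: mem0v.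
  by apply/ffunP => y; rewrite !ffunE meval0 if_same.
have m3 : (m (inord 0) + m (inord 1) <= i)%N.
  rewrite -dm mdegE !big_ord_recl big_ord0.
  rewrite (_ : inord 0 = ord0); last by apply: val_inj; rewrite /= inordK.
  rewrite (_ : inord 1 = lift ord0 ord0); last by apply: val_inj; rewrite /= inordK.
  lia.
have [c cE] := newton_expansion al (m (inord 0)).
have [c' c'E] := newton_expansion al (m (inord 1)).
have -> : [ffun x : L => if Lam x then 'X_[m].@[pt x] else 0] =
  \sum_(k < (m (inord 0%N)).+1) \sum_(l < (m (inord 1%N)).+1) (c k * c' l) *:
    ([ffun y : L => if Lam y then newton k l y else 0] : {ffun L -> K^o}).
  apply/ffunP => x; rewrite sum_ffunE !ffunE.
  under eq_bigr do rewrite sum_ffunE.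
  case: ifP => Lx; last first.
    by rewrite big1 // => k _; rewrite big1 // => l _; rewrite !ffunE Lx scaler0.
  transitivity (al x.1 ^+ m (inord 0) * al x.2 ^+ m (inord 1)).
    rewrite mevalX !big_ord_recl big_ord0 /pt /= expr1n !mulr1.
    by congr (_ ^+ m _ * _ ^+ m _); apply: val_inj; rewrite /= inordK.
  rewrite cE c'E big_distrlr; apply: eq_bigr => k _; apply: eq_bigr => l _ /=.
  by rewrite !ffunE /= (Lx : stair T s x.1 x.2 = true) /newton mulrACA.
apply: memv_suml => k _; apply: memv_suml => l _; apply: memvZ; apply: memN.
by have := ltn_ord k; have := ltn_ord l; lia.
Qed.

(** If the functional vanished on all forms of degree [j], then 1 would lie in the annihilator; but
    1 does not vanish at the point of the cell (0, 0). *)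
Lemma points_gorenstein j : (s <= j)%N -> (0 < T 0)%N ->
  graded_artinian_gorenstein (annihilator points_form j).
Proof.
move=> sj T0.
have L0 : Lam (ord0, ord0) by rewrite /= /stair.
apply: NNPP => nG.
have h1 : (1 : P) \is 0.-homog by exact: dhomog1.
have isj : (0 + s <= j)%N by [].
have : annihilator points_form j 1.
  apply/(annihilator_dual points_form (leq0n j) h1) => q hq.
  rewrite mul1r; apply: NNPP => phiq; apply: nG.
  by apply: (annihilator_gorenstein points_form_linear _ phiq); rewrite -[j]subn0.
move=> /(points_annihilatorP isj h1) /(_ _ L0) /eqP.
by rewrite meval1 oner_eq0.
Qed.
End Points.

(* Evaluation at the points (al a : al b : 1), (a, b) below the staircase, maps forms
   of degree >= s onto all functions on the points, so in degrees i <= s the rank of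
   the pairing is the Hilbert function of the points, and the Newton basis shows that
   the latter counts the cells of the staircase of degree <= i. *)
Lemma gorenstein_of_staircase (K : closedFieldType) (s j : nat) (T : nat -> nat) :
  (s + s <= j)%N -> (0 < T 0)%N -> (forall d, (d <= s)%N -> (T d <= d.+1)%N) ->
  (forall d, (d < s)%N -> T d = d.+1 \/ (T d.+1 <= T d)%N) ->
  exists (J : {mpoly K[3]} -> Prop) (H : nat -> nat),
  [/\ graded_artinian_gorenstein J, hilbert_function J H,
      forall i, (i <= s)%N -> H i = (\sum_(k < i.+1) T k)%N,
      forall i, (i <= j)%N -> H i = H (j - i)%N &
      forall i, (j < i)%N -> H i = 0%N].
Proof.
move=> sj T0 Td TS.
have [sq [usq ssq]] := closed_field_uniq_seq K s.+1.
have al_inj k l : (k <= s)%N -> (l <= s)%N -> nth 0 sq k = nth 0 sq l -> k = l.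
  by move=> ks ls /eqP; rewrite nth_uniq ?ssq // => /eqP.
pose phi := points_form s T (nth 0 sq).
have lphi : is_linear_form phi by exact: points_form_linear.
have iJ := annihilator_ideal j lphi.
exists (annihilator phi j), (fun i => codim i (annihilator phi j)); split.
- by apply: points_gorenstein => //; lia.
- by move=> i; apply: dim_mod_codim; apply: ideal_subspace.
- by move=> i is_; apply: points_codim => //; lia.
- by move=> i ij; apply: (codim_sym lphi iJ) => //; apply: annihilator_dual.
move=> i ji; rewrite /codim (_ : piece _ _ = fullv) ?subnn //.
apply/vspaceP => u; rewrite memvf; apply/pieceP; first exact: ideal_subspace.
by apply: (annihilator_high lphi ji); apply: dhomog_is_dhomog.
Qed.

(** * The dual functional of a Gorenstein ideal *)

Section GorensteinDuality.
Variables (K : fieldType) (n : nat) (I : {mpoly K[n]} -> Prop) (j : nat) (g : {mpoly K[n]}).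
Local Notation P := {mpoly K[n]}.
Hypotheses (GI : graded_artinian_gorenstein I) (hg : g \is j.-homog) (Ig : ~ I g).
Hypothesis topI : forall p : P, p \is j.+1.-homog -> I p.

Let iI : is_ideal I. Proof. by case: GI => [[[]]]. Qed.
Let hI p d : I p -> I (pihomog mdeg d p). Proof. by case: GI => [[[_ H] _] _]; apply: H. Qed.

Lemma scale_notin c : I (c *: g) -> c = 0.
Proof.
move=> Icg; apply/eqP; apply: contra_notT Ig => c0.
by rewrite -[g]scale1r -(mulVf c0) -scalerA; apply: idealZ.
Qed.

Lemma top_in_socle p : p \is j.-homog -> socle_pred I p.
Proof.
move=> hp k; apply: topI; rewrite -addn1; apply: dhomogM => //.
by rewrite dhomogX /= mdeg1.
Qed.

(** [g] spans the one-dimensional socle modulo [I], so [g] and [p] are dependent there. *)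
Lemma socle_line p : socle_pred I p -> exists c, I (p - c *: g).
Proof.
move=> sp; have [_ [_ mx]] := GI.
have nind : ~ lin_indep_mod I [:: g; p].
  move=> /mx H; suff : (2 <= 1)%N by [].
  apply: H => q; rewrite !inE => /orP [] /eqP -> //.
  exact: top_in_socle.
have [c Hc] := not_all_ex_not _ _ nind.
have [Ic nc] := imply_to_and _ _ Hc.
move: Ic; rewrite !big_ord_recl big_ord0 /= addr0 => Ic.
have [c1|c1] := eqVneq (c (lift ord0 ord0)) 0.
  case: nc => k; move: Ic; rewrite c1 scale0r addr0 => /scale_notin c0.
  case: (unliftP ord0 k) => [k' ->|-> //]; rewrite -c1; congr (c (lift _ _)).
  by rewrite ord1.
exists (- (c ord0 / c (lift ord0 ord0))).
have -> : p - - (c ord0 / c (lift ord0 ord0)) *: g =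
   (c (lift ord0 ord0))^-1 *: (c ord0 *: g + c (lift ord0 ord0) *: p).
  by rewrite scalerDr !scalerA mulVf // scale1r scaleNr opprK addrC mulrC.
exact: idealZ.
Qed.

(** Induction on the complementary degree: each [p * 'X_l] inherits the hypothesis one degree
    higher, so [p] is in the socle and equals [c *: g] modulo [I]. For [i < j], taking degree [j]
    parts gives [c = 0]. *)
Lemma pairing_nondegenerate k i p : (i + k = j)%N -> p \is i.-homog ->
  (forall q, q \is k.-homog -> I (p * q)) -> I p.
Proof.
elim: k i p => [|k IHk] i p ikj hp H.
  by have := H 1 (dhomog1 _ _); rewrite mulr1.
have sp : socle_pred I p.
  move=> l; apply: (IHk i.+1); first by lia.
    by rewrite -addn1; apply: dhomogM => //; rewrite dhomogX /= mdeg1.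
  move=> q hq; rewrite -mulrA; apply: H; rewrite -add1n.
  by apply: dhomogM => //; rewrite dhomogX /= mdeg1.
have [c Ic] := socle_line sp.
have := hI j Ic; rewrite linearB linearZ /= (pihomog_dE hg).
rewrite (@pihomog_ne0 _ _ mdeg i) //; last by apply/eqP; lia.
rewrite sub0r -scaleNr => /scale_notin/eqP; rewrite oppr_eq0 => /eqP c0.
by move: Ic; rewrite c0 scale0r subr0.
Qed.

Lemma gorenstein_dual_generator :
  exists phi, is_linear_form phi /\ dual_generator phi j I.
Proof.
have ex p : exists c, I (pihomog mdeg j p - c *: g).
  by apply/socle_line/top_in_socle/pihomogP.
(* The coordinate along [g] of the degree [j] part is chosen pointwise; its linearity comes from its
   uniqueness. *)
pose phi p := proj1_sig (constructive_indefinite_description _ (ex p)).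
have phiP p : I (pihomog mdeg j p - phi p *: g).
  exact: (proj2_sig (constructive_indefinite_description _ (ex p))).
have uniq p c : I (pihomog mdeg j p - c *: g) -> phi p = c.
  move=> H; apply/eqP; rewrite -subr_eq0; apply/eqP/scale_notin.
  have -> : (phi p - c) *: g = (pihomog mdeg j p - c *: g) - (pihomog mdeg j p - phi p *: g).
    by rewrite scalerBl opprB [RHS]addrC addrA subrK.
  exact: idealB.
exists phi; split.
  move=> c p q; apply: uniq; rewrite linearD linearZ /=.
  have -> : c *: pihomog mdeg j p + pihomog mdeg j q - (c * phi p + phi q) *: g =
     c *: (pihomog mdeg j p - phi p *: g) + (pihomog mdeg j q - phi q *: g).
    by rewrite scalerDl scalerBr scalerA opprD addrACA.
  by have [_ ID] := ideal_subspace iI; apply: ID.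
move=> i p ij hp; split=> [Ip q hq|H].
  apply: uniq; rewrite scale0r subr0 pihomog_dE; first exact: idealMl.
  by rewrite -(subnKC ij); apply: dhomogM.
apply: (@pairing_nondegenerate (j - i) i) => //; first by rewrite subnKC.
move=> q hq; have := phiP (p * q).
rewrite H // scale0r subr0 pihomog_dE //.
by rewrite -(subnKC ij); apply: dhomogM.
Qed.
End GorensteinDuality.

(** * Reduction to K[x, y] modulo a linear form *)

Lemma ord4E (k : 'I_4) : [\/ k = inord 0, k = inord 1, k = inord 2 | k = inord 3].
Proof.
case: k => [[|[|[|[|k]]]] lk] //; [apply: Or41|apply: Or42|apply: Or43|apply: Or44];
by apply: val_inj; rewrite /= inordK.
Qed.

Lemma big_ord4 (R : Type) (idx : R) (op : Monoid.law idx) (F : 'I_4 -> R) :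
  \big[op/idx]_(i < 4) F i =
  op (F (inord 0)) (op (F (inord 1)) (op (F (inord 2)) (F (inord 3)))).
Proof.
rewrite !big_ord_recl big_ord0 Monoid.mulm1.
by congr (op (F _) (op (F _) (op (F _) (F _)))); apply: val_inj; rewrite /= inordK.
Qed.

Section FourVariables.
Variable K : fieldType.
Local Notation P := {mpoly K[4]}.
Local Notation w := ('X_(inord 0) : P).
Local Notation x := ('X_(inord 1) : P).
Local Notation y := ('X_(inord 2) : P).
Local Notation z := ('X_(inord 3) : P).

Lemma X_homog k : ('X_k : P) \is 1.-homog.
Proof. by rewrite dhomogX /= mdeg1. Qed.

Lemma mpolyX4 (m : 'X_{1..4}) : ('X_[m] : P) =
  w ^+ m (inord 0) * (x ^+ m (inord 1) * (y ^+ m (inord 2) * z ^+ m (inord 3))).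
Proof. by rewrite mpolyXE_id big_ord4. Qed.

Lemma mdeg4 (m : 'X_{1..4}) :
  mdeg m = (m (inord 0) + (m (inord 1) + (m (inord 2) + m (inord 3))))%N.
Proof. by rewrite mdegE big_ord4. Qed.

Lemma mnm4P (m m' : 'X_{1..4}) : m (inord 0) = m' (inord 0) -> m (inord 1) = m' (inord 1) ->
  m (inord 2) = m' (inord 2) -> m (inord 3) = m' (inord 3) -> m = m'.
Proof. by move=> e0 e1 e2 e3; apply/mnmP => k; case: (ord4E k) => ->. Qed.

(* w |-> 0, x |-> 1, y |-> inner variable, z |-> outer variable of K[y][z]. *)
Definition subst_wx (k : 'I_4) : {poly {poly K}} := nth 0 [:: 0; 1; 'X%:P; 'X] k.
(** With nested univariate polynomials, imposing z = a x at x = 1 is an evaluation of the outer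
    variable. *)
Definition Psi (p : P) : {poly {poly K}} := mmap (polyC \o polyC) subst_wx p.

Lemma PsiM p q : Psi (p * q) = Psi p * Psi q.
Proof. exact: rmorphM. Qed.
Lemma PsiB p q : Psi (p - q) = Psi p - Psi q.
Proof. exact: rmorphB. Qed.
Lemma PsiZ c p : Psi (c *: p) = c%:P%:P * Psi p.
Proof. exact: mmapZ. Qed.
Lemma PsiD p q : Psi (p + q) = Psi p + Psi q.
Proof. exact: rmorphD. Qed.
Lemma Psi0 : Psi 0 = 0.
Proof. exact: rmorph0. Qed.

Lemma PsiXU k : Psi 'X_k = subst_wx k.
Proof. by rewrite /Psi mmapX mmap1U. Qed.

Lemma Psi_w : Psi w = 0. Proof. by rewrite PsiXU /subst_wx inordK. Qed.
Lemma Psi_x : Psi x = 1. Proof. by rewrite PsiXU /subst_wx inordK. Qed.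
Lemma Psi_y : Psi y = 'X%:P. Proof. by rewrite PsiXU /subst_wx inordK. Qed.
Lemma Psi_z : Psi z = 'X. Proof. by rewrite PsiXU /subst_wx inordK. Qed.

Lemma PsiXn k e : Psi ('X_k ^+ e) = Psi 'X_k ^+ e.
Proof. exact: rmorphXn. Qed.

Lemma PsiX m : Psi 'X_[m] =
  if m (inord 0) == 0%N then ('X^(m (inord 2)))%:P * 'X^(m (inord 3)) else 0.
Proof.
rewrite mpolyX4 !PsiM !PsiXn Psi_w Psi_x Psi_y Psi_z expr0n expr1n mul1r.
by case: eqP => _; rewrite ?mul0r // mul1r polyC_exp.
Qed.

(** In a fixed degree the other exponents determine that of x, so setting x = 1 merges no two
    monomials free of w. *)
Lemma Psi_coef i p (m : 'X_{1..4}) : p \is i.-homog -> mdeg m = i -> m (inord 0) = 0%N ->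
  (Psi p)`_(m (inord 3))`_(m (inord 2)) = p@_m.
Proof.
move=> hp dm m0; elim/homog_monomial_ind: hp => {p} [c p q Hp Hq||m' dm'].
- by rewrite PsiD PsiZ coefD coefCM coefD coefCM Hp Hq mcoeffD mcoeffZ.
- by rewrite Psi0 !coef0 mcoeff0.
rewrite PsiX mcoeffX; case: (eqVneq m' m) => [->|ne].
  by rewrite m0 eqxx coefCM !coefXn eqxx mulr1 coefXn eqxx.
case: eqP => m0'; last by rewrite !coef0.
rewrite coefCM coefXn; case: eqP => e3; last by rewrite mulr0 coef0.
rewrite mulr1 coefXn; case: eqP => e2 //.
case/eqP: ne; apply: mnm4P => //; first by rewrite m0 m0'.
by move: dm dm'; rewrite !mdeg4; lia.
Qed.

Definition psi (a : K) (p : P) : {poly K} := (Psi p).[a%:P].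

Lemma psiM a p q : psi a (p * q) = psi a p * psi a q.
Proof. by rewrite /psi PsiM hornerM. Qed.
Lemma psiD a p q : psi a (p + q) = psi a p + psi a q.
Proof. by rewrite /psi PsiD hornerD. Qed.
Lemma psiB a p q : psi a (p - q) = psi a p - psi a q.
Proof. by rewrite /psi PsiB hornerD hornerN. Qed.
Lemma psiZ a c p : psi a (c *: p) = c *: psi a p.
Proof. by rewrite /psi PsiZ hornerM hornerC mul_polyC. Qed.
Lemma psi0 a : psi a 0 = 0.
Proof. by rewrite /psi Psi0 horner0. Qed.

Lemma psiX a m : psi a 'X_[m] =
  if m (inord 0) == 0%N then a ^+ m (inord 3) *: 'X^(m (inord 2)) else 0.
Proof.
rewrite /psi PsiX; case: ifP => _; last by rewrite horner0.
by rewrite hornerM hornerC hornerXn -polyC_exp mulrC mul_polyC.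
Qed.

Lemma size_psi a i p : p \is i.-homog -> (size (psi a p) <= i.+1)%N.
Proof.
move=> hp; elim/homog_monomial_ind: hp => {p} [c p q Hp Hq||m dm].
- rewrite psiD psiZ (leq_trans (size_polyD _ _)) // geq_max Hq andbT.
  exact: leq_trans (size_scale_leq _ _) Hp.
- by rewrite psi0 size_poly0.
rewrite psiX; case: ifP => _; last by rewrite size_poly0.
rewrite (leq_trans (size_scale_leq _ _)) // size_polyXn ltnS.
by move: dm; rewrite mdeg4; lia.
Qed.

Definition ell (a : K) : P := z - a *: x.

Lemma ell_homog a : ell a \is 1.-homog.
Proof. by apply: rpredB; [|apply: rpredZ]; apply: X_homog. Qed.

Lemma Psi_ell a : Psi (ell a) = 'X - a%:P%:P.
Proof. by rewrite /ell PsiB PsiZ Psi_x Psi_z mulr1. Qed.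

Lemma psi_ell a : psi a (ell a) = 0.
Proof. by rewrite /psi Psi_ell !hornerE subrr. Qed.

Section Ideal.
Variable I : P -> Prop.
Hypotheses (iI : is_ideal I) (hI : forall p d, I p -> I (pihomog mdeg d p)).
Hypotheses (Iww : I (w * w)) (Iwx : I (w * x)) (Iwy : I (w * y)).

Lemma monomial_in_ideal (m : 'X_{1..4}) : (0 < m (inord 0))%N ->
  (1 < m (inord 0))%N || (0 < m (inord 1))%N || (0 < m (inord 2))%N -> I 'X_[m].
Proof.
have IM r p : I p -> I (r * p) by case: iI => _ _; apply.
rewrite mpolyX4; case: (m (inord 0)) => [//|[|e0]] _ /=.
  rewrite expr1; case: (m (inord 1)) => [|e1] /=.
    case: (m (inord 2)) => [//|e2] _; rewrite expr0 mul1r !exprS.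
    rewrite (_ : _ * _ = (y ^+ e2 * z ^+ m (inord 3)) * (w * y)); last by ring.
    exact: IM.
  move=> _; rewrite exprS.
  rewrite (_ : _ * _ = (x ^+ e1 * (y ^+ m (inord 2) * z ^+ m (inord 3))) * (w * x)); last by ring.
  exact: IM.
move=> _; rewrite !exprS.
rewrite (_ : _ * _ = (w ^+ e0 * (x ^+ m (inord 1) *
  (y ^+ m (inord 2) * z ^+ m (inord 3)))) * (w * w)); last by ring.
exact: IM.
Qed.

(** Every monomial of [p] contains w, and modulo w^2, wx, wy the only such monomial left is w
    z^i. *)
Lemma Psi_eq0_normal_form i p : p \is i.+1.-homog -> Psi p = 0 ->
  exists c, I (p - c *: (w * z ^+ i)).
Proof.
move=> hp P0; pose ms : 'X_{1..4} := (U_(inord 0) + U_(inord 3) *+ i)%MM.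
have XE : w * z ^+ i = 'X_[ms] by rewrite mpolyXD mpolyXn.
have msE k : ms k = ((inord 0 == k) + (inord 3 == k) * i)%N.
  by rewrite /ms mnmDE mulmnE !mnm1E.
exists (p@_ms); rewrite XE.
have -> : p - p@_ms *: 'X_[ms] = \sum_(m <- msupp p | m != ms) p@_m *: 'X_[m].
  rewrite {1}(mpolyE p) (bigID (pred1 ms)) /= addrAC.
  suff -> : \sum_(m <- msupp p | m == ms) p@_m *: 'X_[m] = p@_ms *: 'X_[ms].
    by rewrite subrr add0r.
  case: (boolP (ms \in msupp p)) => msp.
    by rewrite -big_filter filter_pred1_uniq ?msupp_uniq // big_seq1.
  rewrite (memN_msupp_eq0 msp) scale0r big1_seq // => m /andP[/eqP -> h].
  by rewrite h in msp.
apply: ideal_sum => // m mp mms; apply: idealZ => //.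
have dm : mdeg m = i.+1 by apply: (dhomog_mf hp).
have m0 : (0 < m (inord 0))%N.
  rewrite lt0n; apply: contraTneq mp => m0.
  by rewrite -mcoeff_eq0 -(Psi_coef hp dm m0) P0 !coef0.
apply: monomial_in_ideal => //.
apply: contraNT mms; rewrite !negb_or -!leqNgt => /andP[/andP[h0 h1] h2].
have inE a b : (a < 4)%N -> (b < 4)%N -> ((inord a : 'I_4) == inord b) = (a == b).
  by move=> la lb; rewrite -val_eqE /= !inordK.
apply/eqP; move: dm; rewrite mdeg4 => dm.
by apply: mnm4P; rewrite msE !inE //=; lia.
Qed.

(** [Psi] sends [ell a] to a nonzero element of a domain, so [Psi p = 0] and [p] is c w z^i modulo
    [I]. Multiplying by [ell a] gives c w z^(i+1) modulo [I], which forces c = 0. *)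
Lemma colon_ell_trivial a i p :
  (forall q, q \is i.+2.-homog -> I q -> Psi q = 0) ->
  ~ I (w * z ^+ i.+1) -> p \is i.+1.-homog -> I (ell a * p) -> I p.
Proof.
move=> PI nI hp Ilp.
have hlp : ell a * p \is i.+2.-homog.
  by rewrite -[i.+2]add1n; apply: dhomogM => //; apply: ell_homog.
have := PI _ hlp Ilp; rewrite PsiM Psi_ell => /eqP.
rewrite mulf_eq0 polyXsubC_eq0 /= => /eqP P0.
have [c Ic] := Psi_eq0_normal_form hp P0.
have c0 : c = 0.
  apply/eqP; apply: contra_notT nI => c0.
  have [_ ID IM] := iI.
  have H : I (c *: (w * z ^+ i.+1)).
    have -> : c *: (w * z ^+ i.+1) = ell a * p - ell a * (p - c *: (w * z ^+ i)) +
        ((c * a) *: z ^+ i) * (w * x).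
      rewrite /ell exprS -!mul_mpolyC mpolyCM; ring.
    apply: ID; last exact: IM.
    by apply: idealB => //; apply: IM.
  by rewrite -[_ * _]scale1r -(mulVf c0) -scalerA; apply: idealZ.
by move: Ic; rewrite c0 scale0r subr0.
Qed.

(** The ideal I + (l). *)
Definition hyperplane (a : K) (p : P) : Prop := exists r, I (p - ell a * r).

Lemma hyperplane_ideal a : is_ideal (hyperplane a).
Proof.
have [I0 ID IM] := iI; split.
- by exists 0; rewrite mulr0 subr0.
- move=> p q [r Hr] [s Hs]; exists (r + s).
  by rewrite mulrDr opprD addrACA; apply: ID.
move=> s p [r Hr]; exists (s * r).
by rewrite mulrCA -mulrBr; apply: IM.
Qed.

Lemma sub_hyperplane a p : I p -> hyperplane a p.
Proof. by exists 0; rewrite mulr0 subr0. Qed.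

Lemma hyperplane_homog a i p : p \is i.+1.-homog -> hyperplane a p ->
  exists r, r \is i.-homog /\ I (p - ell a * r).
Proof.
move=> hp [r /(hI i.+1)]; rewrite linearB /= (pihomog_dE hp) -[X in pihomog _ X _]add1n.
rewrite (pihomog_homogMl i _ (ell_homog a)) => H.
by exists (pihomog mdeg i r); split=> //; apply: pihomogP.
Qed.

(** Modulo I + (l) a form is congruent to the lift [sec] of its image in K[x, y]. The bound [1 < i]
    matters because [psi a] also kills w: it guarantees that the leftover monomial w z^(i-1)
    contains w z, which is congruent to a w x. *)
Lemma psi_eq0_hyperplane a i p : (1 < i)%N -> p \is i.-homog -> psi a p = 0 ->
  hyperplane a p.
Proof.
move=> i2 hp.
pose sec (f : {poly K}) : P := \sum_(b < i.+1) f`_b *: (x ^+ (i - b) * y ^+ b).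
have iQ := hyperplane_ideal a.
have [Q0 QD QM] := iQ.
suff H : hyperplane a (p - sec (psi a p)).
  move=> p0; move: H; rewrite p0 /sec big1 ?subr0 // => b _.
  by rewrite coef0 scale0r.
elim/homog_monomial_ind: hp => {p} [c p q Hp Hq||m dm].
- have -> : c *: p + q - sec (psi a (c *: p + q)) =
      c *: (p - sec (psi a p)) + (q - sec (psi a q)).
    rewrite scalerBr addrACA -opprD; congr (_ - _).
    rewrite /sec scaler_sumr -big_split; apply: eq_bigr => b _ /=.
    by rewrite psiD psiZ coefD coefZ scalerDl scalerA.
  by apply: QD => //; apply: idealZ.
- by rewrite psi0 /sec big1 ?subr0 // => b _; rewrite coef0 scale0r.
rewrite psiX; case: eqP => [m0|/eqP]; last first.
  rewrite -lt0n => m0; rewrite /sec big1 ?subr0 => [|b _]; last by rewrite coef0 scale0r.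
  have [h|h] := boolP ((1 < m (inord 0))%N || (0 < m (inord 1))%N || (0 < m (inord 2))%N).
    exact/sub_hyperplane/monomial_in_ideal.
  move: h; rewrite !negb_or -!leqNgt => /andP[/andP[h0 h1] h2].
  move: dm; rewrite mdeg4 => dm.
  have e3 : m (inord 3) = (m (inord 3)).-1.+1 by lia.
  have e0 : m (inord 0) = (m (inord 0)).-1.+1 by lia.
  rewrite mpolyX4 e3 e0 !exprS.
  rewrite (_ : _ * _ = (w ^+ (m (inord 0)).-1 * (x ^+ m (inord 1) *
    (y ^+ m (inord 2) * z ^+ (m (inord 3)).-1))) * (w * z)); last by ring.
  apply: QM; exists w; rewrite /ell.
  rewrite (_ : _ - _ = a *: (w * x)); last by rewrite -!mul_mpolyC; ring.
  exact: idealZ.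
have m2i : (m (inord 2) < i.+1)%N by move: dm; rewrite mdeg4; lia.
rewrite /sec (bigD1 (Ordinal m2i)) //= big1 => [|b /negPf ne]; last first.
  by rewrite coefZ coefXn -(val_eqE b (Ordinal m2i)) /= in ne *; rewrite ne mulr0 scale0r.
rewrite addr0 coefZ coefXn eqxx mulr1 mpolyX4 m0 expr0 mul1r.
have -> : (i - m (inord 2))%N = (m (inord 1) + m (inord 3))%N.
  by move: dm; rewrite mdeg4 m0; lia.
have -> : x ^+ m (inord 1) * (y ^+ m (inord 2) * z ^+ m (inord 3)) -
    a ^+ m (inord 3) *: (x ^+ (m (inord 1) + m (inord 3)) * y ^+ m (inord 2)) =
    (x ^+ m (inord 1) * y ^+ m (inord 2)) * (z ^+ m (inord 3) - (a *: x) ^+ m (inord 3)).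
  by rewrite exprZn exprD -!mul_mpolyC; ring.
have [s Hs] : exists s, z ^+ m (inord 3) - (a *: x) ^+ m (inord 3) = ell a * s.
  by rewrite subrXX; eexists.
by apply: QM; exists s; rewrite Hs subrr; case: iI.
Qed.
End Ideal.
End FourVariables.

(* Were the two dimensions equal, V would be stable under multiplication by 'X,
   which is impossible for polynomials of bounded degree. *)
Lemma dim_shift_lt (K : fieldType) m (V : {vspace 'rV[K]_m}) (W : {vspace 'rV[K]_m.+1}) :
  (forall u, u \in V -> poly_rV (rVpoly u) \in W /\ poly_rV ('X * rVpoly u) \in W) ->
  (0 < \dim V)%N -> (\dim V < \dim W)%N.
Proof.
move=> VW V0.
have szu (u : 'rV[K]_m) : (size (rVpoly u) <= m)%N by exact: size_poly.
have szX (u : 'rV[K]_m) : (size ('X * rVpoly u)%R <= m.+1)%N.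
  by rewrite (leq_trans (size_polyMleq _ _)) // size_polyX; have := szu u; lia.
have [|f fE] := @linear_hom K _ _ (fun u : 'rV[K]_m => poly_rV (rVpoly u) : 'rV[K]_m.+1).
  by move=> c u v; rewrite !linearP.
have ker_f : lker f == 0%VS.
  apply/lker0P => u v; rewrite !fE => /(congr1 rVpoly).
  rewrite !poly_rV_K ?(leq_trans (szu _)) // => /(congr1 (@poly_rV K m)).
  by rewrite !rVpolyK.
have dimf : \dim (f @: V) = \dim V.
  by apply: limg_dim_eq; rewrite (eqP ker_f) capv0.
have sfW : (f @: V <= W)%VS.
  by apply/subvP => _ /memv_imgP [u uV ->]; rewrite fE; have [] := VW u uV.
rewrite ltnNge; apply/negP => dW.
have /eqP fVW : (f @: V)%VS == W by rewrite eqEdim sfW dimf.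
have step u : u \in V -> exists2 u', u' \in V & rVpoly u' = 'X * rVpoly u.
  move=> uV; have [_] := VW u uV; rewrite -fVW => /memv_imgP [u' u'V].
  rewrite fE => /(congr1 rVpoly); rewrite !poly_rV_K ?(leq_trans (szu _)) //.
  by move=> ->; exists u'.
pose u0 := vpick V.
have u0n : rVpoly u0 != 0.
  apply: contraTneq V0 => /(congr1 (@poly_rV K m)); rewrite rVpolyK linear0 => /eqP.
  by rewrite vpick0 => /eqP ->; rewrite dimv0.
have it k : exists2 u, u \in V & rVpoly u = 'X^k * rVpoly u0.
  elim: k => [|k [u uV E]]; first by exists u0; [exact: memv_pick | rewrite expr0 mul1r].
  by have [u' u'V E'] := step u uV; exists u' => //; rewrite E' E exprS mulrA.
have [u uV E] := it m.
have := szu u; rewrite E mulrC size_mulXn // => h.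
have h0 : (0 < size (rVpoly u0))%N by rewrite size_poly_gt0.
by move: h h0; rewrite -[X in (_ <= X)%N]addn0 leq_add2l leqn0 => /eqP ->.
Qed.

(** * The exact sequence of l and the image of I in K[x, y] *)

Section Slices.
Variables (K : fieldType) (I : {mpoly K[4]} -> Prop) (a : K).
Local Notation P := {mpoly K[4]}.
Local Notation R := (dhomog 4 K).
Local Notation w := ('X_(inord 0) : P).
Local Notation x := ('X_(inord 1) : P).
Local Notation y := ('X_(inord 2) : P).
Local Notation z := ('X_(inord 3) : P).
Hypotheses (iI : is_ideal I) (hI : forall p d, I p -> I (pihomog mdeg d p)).
Hypotheses (Iww : I (w * w)) (Iwx : I (w * x)) (Iwy : I (w * y)).
Local Notation colon := (fun p => I (ell a * p)).

Lemma colon_subspace : is_subspace colon.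
Proof.
have [I0 ID] := ideal_subspace iI.
by split=> [|c u v Iu Iv]; [rewrite mulr0 | rewrite mulrDr -scalerAr; apply: ID].
Qed.

(** Multiplication by l embeds R_i into R_(i+1), and its image meets I in the image of (I : l)_i;
    the rest is the dimension formula for a sum. *)
Lemma codim_exact i : codim i.+1 I = (codim i.+1 (hyperplane I a) + codim i colon)%N.
Proof.
have sI := ideal_subspace iI.
have sQ := ideal_subspace (hyperplane_ideal iI a).
have sC := colon_subspace.
have hl (u : R i) : ell a * (u : P) \is i.+1.-homog.
  by rewrite -[i.+1]add1n; exact: dhomogM (ell_homog a) (dhomog_is_dhomog u).
have [|f fE] := @linear_hom K _ _ (fun u : R i => DHomog (hl u)).
  by move=> c u v; apply: val_inj; rewrite /= mulrDr -scalerAr.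
have fEv u : (f u : P) = ell a * (u : P) by rewrite fE.
have ell0 : ell a != 0.
  apply/eqP => E; have := Psi_ell a; rewrite E Psi0 => /esym/eqP.
  by rewrite polyXsubC_eq0.
have kf : lker f == 0%VS.
  apply/lker0P => u v /(congr1 (@mpoly_of_dhomog _ _ _)); rewrite !fEv.
  by move=> /(mulfI ell0) E; apply: val_inj.
have dimf U : \dim (f @: U) = \dim U.
  by apply: limg_dim_eq; rewrite (eqP kf) capv0.
have E1 : piece i.+1 (hyperplane I a) = (piece i.+1 I + limg f)%VS.
  apply/vspaceP => u; apply/idP/idP.
    move=> /pieceP - /(_ sQ) /(hyperplane_homog hI (dhomog_is_dhomog u)) [r [hr Ir]].
    have -> : u = (u - f (DHomog hr)) + f (DHomog hr) by rewrite subrK.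
    apply: memv_add; last exact: memv_img (memvf _).
    by apply/pieceP => //; rewrite linearB /= fEv.
  move=> /memv_addP [u1 /pieceP - /(_ sI) Iu1 [_ /memv_imgP [v _ ->] ->]].
  apply/pieceP => //; exists (v : P); rewrite linearD /= fEv addrK.
  exact: Iu1.
have E2 : (piece i.+1 I :&: limg f)%VS = (f @: piece i colon)%VS.
  apply/vspaceP => u; rewrite memv_cap; apply/andP/idP.
    move=> [/pieceP - /(_ sI) Iu /memv_imgP [v _ E]]; rewrite E.
    by apply: memv_img; apply/pieceP => //; rewrite -fEv -E.
  move=> /memv_imgP [v /pieceP - /(_ sC) Iv ->]; split; last exact: memv_img (memvf _).
  by apply/pieceP => //; rewrite fEv.
have := dimv_sum_cap (piece i.+1 I) (limg f); rewrite -E1 E2 !dimf => E.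
have := dimvS (subvf (piece i.+1 (hyperplane I a))).
have := dimvS (subvf (piece i colon)).
rewrite /codim; move: E.
move: (\dim (piece i.+1 _)) (\dim (piece i.+1 I)) (\dim (piece i colon)) => A B C.
move: (\dim fullv) (\dim fullv) => D F; lia.
Qed.

(** [psi a] maps forms of degree [i] onto polynomials of degree at most [i]. It kills l, so I and I
    + (l) have the same image, and for [1 < i] its kernel lies in I + (l). *)
Lemma slice_image i : exists V : {vspace 'rV[K]_i.+1},
  (forall v, v \in V <-> exists2 p, p \is i.-homog /\ I p & v = poly_rV (psi a p)) /\
  ((1 < i)%N -> (codim i (hyperplane I a) + \dim V = i.+1)%N).
Proof.
have sI := ideal_subspace iI.
have iQ := hyperplane_ideal iI a.
have sQ := ideal_subspace iQ.
have [|f fE] := @linear_hom K _ _ (fun u : R i => poly_rV (psi a u) : 'rV[K]_i.+1).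
  by move=> c u v; rewrite /= psiD psiZ linearP.
exists (f @: piece i I)%VS; split=> [v|i2].
  split=> [/memv_imgP [u /pieceP - /(_ sI) Iu ->]|[p [hp Ip] ->]].
    by exists (u : P); rewrite ?fE //; split=> //; apply: dhomog_is_dhomog.
  by rewrite -(fE (DHomog hp)); apply: memv_img; apply/pieceP.
have kQ : (lker f <= piece i (hyperplane I a))%VS.
  apply/subvP => u; rewrite memv_ker fE => /eqP E; apply/pieceP => //.
  apply: (psi_eq0_hyperplane iI Iww Iwx Iwy i2 (dhomog_is_dhomog u)).
  rewrite -[psi _ _](@poly_rV_K _ i.+1) ?E ?linear0 //.
  exact: size_psi (dhomog_is_dhomog u).
have hq p : p \is i.-homog -> hyperplane I a p ->
    exists r, ell a * r \is i.-homog /\ I (p - ell a * r).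
  case: (i) i2 => [//|k] _ hp /(hyperplane_homog hI hp) [r [hr Ir]].
  exists r; split=> //; rewrite -[k.+1]add1n.
  by apply: dhomogM => //; apply: ell_homog.
have fQ : (f @: piece i (hyperplane I a) = f @: piece i I)%VS.
  apply/vspaceP => v; apply/memv_imgP/memv_imgP => -[u uU ->]; last first.
    exists u => //; apply/pieceP => //; apply: sub_hyperplane.
    by move: uU => /pieceP; apply.
  move: uU => /pieceP - /(_ sQ) /(hq _ (dhomog_is_dhomog u)) [r [hr Ir]].
  have hd : (u : P) - ell a * r \is i.-homog.
    by apply: rpredB => //; apply: dhomog_is_dhomog.
  exists (DHomog hd); first by apply/pieceP.
  by rewrite !fE /= psiB psiM psi_ell mul0r subr0.
have limf : limg f = fullv.
  apply/eqP; rewrite eqEsubv subvf; apply/subvP => v _.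
  pose p : P := \sum_(b < i.+1) v 0 b *: (x ^+ (i - b) * y ^+ b).
  have hp : p \is i.-homog.
    apply: rpred_sum => b _; apply: rpredZ.
    have h1 := dhomogMn (i - b) (X_homog K (inord 1)).
    have h2 := dhomogMn b (X_homog K (inord 2)).
    by have := dhomogM h1 h2; rewrite !mul1n subnK // -ltnS.
  suff -> : v = f (DHomog hp) by exact: memv_img (memvf _).
  rewrite fE /= -[LHS]rVpolyK; congr poly_rV.
  have psi_sum (F : 'I_i.+1 -> P) : psi a (\sum_b F b) = \sum_b psi a (F b).
    apply: (big_ind2 (fun q r => psi a q = r)) => //; first exact: psi0.
    by move=> q1 r1 q2 r2 <- <-; rewrite psiD.
  rewrite /p psi_sum; apply/polyP => k; rewrite coef_rVpoly coef_sum.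
  have mono (b : 'I_i.+1) : psi a (v 0 b *: (x ^+ (i - b) * y ^+ b)) = v 0 b *: 'X^b.
    rewrite psiZ psiM; congr (_ *: _).
    by rewrite /psi !PsiXn Psi_x Psi_y expr1n hornerC mul1r -polyC_exp hornerC.
  case: insubP => [b _ <-|].
    rewrite (bigD1 b) //= mono coefZ coefXn eqxx mulr1 big1 ?addr0 // => l /negPf lb.
    rewrite mono coefZ coefXn (_ : (val b == l :> nat) = false) ?mulr0 //.
    by rewrite (val_eqE b l) eq_sym.
  rewrite -leqNgt => ik; rewrite big1 // => b _; rewrite mono coefZ coefXn.
  by case: eqP => [E|_]; [have := ltn_ord b; lia | rewrite mulr0].
have D1 := limg_ker_dim f fullv; have D2 := limg_ker_dim f (piece i (hyperplane I a)).
have := dimvS (subvf (piece i (hyperplane I a))).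
have dV : \dim {:'rV[K]_i.+1} = i.+1 by rewrite dimvf; exact: mul1n.
rewrite capfv limf dV in D1.
rewrite fQ (capv_idPr kQ) in D2.
rewrite /codim -D1 -D2; move: (\dim _) (\dim _) => A B; lia.
Qed.
End Slices.

(** * From the slice to the Hilbert function *)

Lemma exists_least (A : nat -> Prop) : (exists i, A i) ->
  exists i, A i /\ forall k, (k < i)%N -> ~ A k.
Proof.
move=> [i Ai]; apply: NNPP => H.
have N : forall m k, (k < m)%N -> ~ A k.
  elim=> [//|m IH] k; rewrite ltnS leq_eqVlt => /orP [/eqP ->|]; last exact: IH.
  by move=> Am; apply: H; exists m.
exact: (N i.+1 i).
Qed.

(* In degree i: h is the Hilbert function of R/I, c that of R/(I, l) for a linear
   form l, r the rank of multiplication by l on R/I, and v the dimension of the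
   image of I in K[x, y]; nu is the least degree in which that image is nonzero. *)
Section HilbertNumerics.
Variables (h c r v : nat -> nat) (j nu : nat).
Hypotheses (h_exact : forall i, h i.+1 = (c i.+1 + r i)%N)
  (r_sym : forall i, (i < j)%N -> r i = r (j.-1 - i)%N)
  (h_sym : forall i, (i <= j)%N -> h i = h (j - i)%N)
  (c_v : forall i, (1 < i)%N -> (c i + v i = i.+1)%N)
  (v_lt : forall i, (1 < i)%N -> (0 < v i)%N -> (v i < v i.+1)%N)
  (nu_gt2 : (2 < nu)%N)
  (v_low : forall i, (1 < i)%N -> (i < nu)%N -> v i = 0%N)
  (v_nu : (0 < v nu)%N)
  (r_low : forall i, (0 < i)%N -> (i.+1 < nu)%N -> (i < j)%N -> r i = h i)
  (h0 : h 0%N = 1%N) (h1 : h 1%N = 4%N) (j_gt0 : (0 < j)%N).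

(** The values 1, 4, 7 are distinct, while j = 1, 2, 3 would force h 0 = h 1, h 0 = h 2, h 1 = h 2
    respectively. *)
Lemma socle_degree_ge4 : (3 < j)%N /\ h 2 = 7%N.
Proof.
have h2 : (1 < j)%N -> h 2 = 7%N.
  move=> j1; rewrite h_exact r_low ?h1 //.
  by have := c_v (isT : (1 < 2)%N); rewrite v_low //; lia.
have [j1|j1] := leqP j 1.
  have ej : j = 1%N by lia.
  by have := @h_sym 0 isT; rewrite subn0 ej h0 h1.
have [j2|j2] := leqP j 2.
  have ej : j = 2%N by lia.
  by have := @h_sym 0 isT; rewrite subn0 ej h0 h2.
have [j3|j3] := leqP j 3; last by split=> //; apply: h2.
have ej : j = 3%N by lia.
by have := @h_sym 1 j_gt0; rewrite ej h1 h2.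
Qed.

(** From [nu] on [v] grows strictly, so [c i = i + 1 - v i] cannot increase. The range starts at
    [nu.-1], where [c] is still full. *)
Lemma quotient_antitone i k : (nu.-1 <= i)%N -> (i <= k)%N -> (c k <= c i)%N.
Proof.
have vpos : forall m, (0 < v (nu + m))%N.
  elim=> [|m IH]; first by rewrite addn0.
  by rewrite addnS; apply: leq_trans (v_lt _ IH); lia.
have step m : (nu.-1 <= m)%N -> (c m.+1 <= c m)%N.
  move=> num; have [mn|mn] := ltnP m nu.
    have em : m.+1 = nu by lia.
    have := @c_v m; have := @v_low m; have := @c_v m.+1; rewrite em; lia.
  have := @v_lt m; have := vpos (m - nu)%N; rewrite subnKC //.
  have := @c_v m; have := @c_v m.+1; lia.
move=> nui; elim: k => [|k IH]; first by rewrite leqn0 => /eqP ->.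
rewrite leq_eqVlt => /orP [/eqP <- //|ik].
have := step k; have := IH ik; lia.
Qed.

Lemma hilbert_difference i : (1 < i)%N -> (i < j)%N ->
  (h i + c (j.+1 - i) = c i + h i.-1)%N.
Proof.
case: i => [//|i] i1 ij /=.
have e1 : (j.+1 - i.+1 = (j - i.+1).+1)%N by lia.
have := h_sym (ltnW (ltnW ij)).
rewrite (h_exact i) e1 (_ : j - i = (j - i.+1).+1)%N; last by lia.
rewrite (h_exact (j - i.+1)) (r_sym (ltnW ij)).
rewrite (_ : j.-1 - i = j - i.+1)%N; last by lia.
lia.
Qed.

(* The first difference of h, except for the value 2 instead of 3 at i = 1. *)
Definition halfdiff i := if (i <= 1)%N then i.+1 else (h i - h i.-1)%N.

(** For 2 <= d <= j/2 the entry is c d - c (j + 1 - d). As d increases from [nu.-1] on, [c d] does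
    not increase and [c (j + 1 - d)] does not decrease; for 2 <= d < nu the entry is d + 1. *)
Lemma halfdiff_spec : let T := halfdiff in
  [/\ forall i, (1 < i)%N -> (i <= j./2)%N -> h i = (h i.-1 + T i)%N,
      forall d, (d <= j./2)%N -> (T d <= d.+1)%N &
      forall d, (d < j./2)%N -> T d = d.+1 \/ (T d.+1 <= T d)%N].
Proof.
have [j4 _] := socle_degree_ge4.
have low i : (1 < i)%N -> (i <= j./2)%N -> (i < nu)%N -> h i = (h i.-1 + i.+1)%N.
  case: i => [//|i] i1 ij inu; rewrite h_exact r_low //=; try lia.
  by have := c_v i1; rewrite v_low //; lia.
have high i : (1 < i)%N -> (i <= j./2)%N -> (nu <= i)%N -> (h i.-1 <= h i)%N.
  move=> i1 ij inu; have := @hilbert_difference i i1; have := @quotient_antitone i (j.+1 - i).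
  lia.
have up i : (1 < i)%N -> (i <= j./2)%N -> h i = (h i.-1 + halfdiff i)%N.
  move=> i1 ij; rewrite /halfdiff leqNgt i1 /=.
  case: (ltnP i nu) => inu; first by rewrite (low i) //; lia.
  by have := high i i1 ij inu; lia.
have ci i : (1 < i)%N -> (c i <= i.+1)%N by move=> i1; have := c_v i1; lia.
split=> // d dj.
  have [d1|d1] := leqP d 1; first by rewrite /halfdiff d1.
  by have := up d d1 dj; have := @hilbert_difference d d1; have := ci d d1; lia.
have [d1|d1] := leqP d 1; first by left; rewrite /halfdiff d1.
have [dn|dn] := ltnP d nu.-1.
  by left; have := up d d1 (ltnW dj); have := low d d1 (ltnW dj); lia.
right.
have := up d d1 (ltnW dj); have := up d.+1 (ltnW d1) dj.
have := @hilbert_difference d d1; have := @hilbert_difference d.+1 (ltnW d1).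
have := @quotient_antitone d d.+1 dn (leqnSn d).
have := @quotient_antitone (j.+1 - d.+1) (j.+1 - d).
lia.
Qed.

(** The added 1 makes up for [halfdiff 1 = 2] where [h] rises by 3; it becomes the gap between [H]
    and [H']. *)
Lemma hilbert_sum i : (0 < i)%N -> (i <= j./2)%N ->
  h i = (\sum_(k < i.+1) halfdiff k + 1)%N.
Proof.
have [up _ _] := halfdiff_spec.
elim: i => [//|[|i] IH] _ ij; first by rewrite h1 !big_ord_recr big_ord0.
rewrite (up i.+2) //= IH //; last exact: ltnW.
by rewrite [in RHS]big_ord_recr /=; lia.
Qed.

Lemma halfdiff_O_sequence : O_sequence (DeltaH_half h j).
Proof.
have [j4 h2] := socle_degree_ge4.
have [up le lev] := halfdiff_spec.
have szD : size (DeltaH_half h j) = (j./2).+1 by rewrite size_map size_iota.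
have nthD i : (i < (j./2).+1)%N -> (DeltaH_half h j)`_i =
    (if i == 1%N then 3 else halfdiff i)%:Z.
  move=> ij; rewrite (nth_map 0%N) ?size_iota // nth_iota // add0n.
  case: i ij => [|[|i]] ij; first by rewrite h0.
    by rewrite h0 h1.
  by rewrite (up i.+2) //= PoszD addrAC subrr add0r.
split=> [|i|d d1]; first by rewrite nthD.
  by rewrite szD => ij; rewrite nthD.
rewrite szD => dj; rewrite !nthD //; last exact: ltnW.
rewrite !absz_nat.
have [->|dn1] := eqVneq d 1%N.
  (* In degree 1 the true difference is 3 = C(3, 1), which allows C(4, 2) = 6; the next entry is 7 -
     4 = 3. *)
  exists (fun=> 3); rewrite /macaulay_rep /macaulay_upper !big_nat1 /=.
  rewrite /halfdiff /= h2 h1; split=> //; split=> // i; lia.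
rewrite (_ : (d.+1 == 1%N) = false); last by apply/eqP; lia.
have d2 : (1 < d)%N by lia.
have Td : (halfdiff d <= d.+1)%N by apply: le; lia.
have [full|Tlt] := eqVneq (halfdiff d) d.+1.
  (* Here d + 1 = C(d+1, d), the lower terms C(i-1, i) being 0, and the bound is C(d+2, d+1) = d +
     2. *)
  exists (fun i => if i == d then d.+1 else i.-1); rewrite /macaulay_rep /macaulay_upper.
  split; first split.
  - move=> i i1 id; rewrite (ltn_eqF id); case: eqP => [|_]; lia.
  - rewrite full big_nat_recr //= eqxx binSn big_nat_cond big1 // => i.
    by rewrite andbT => /andP [i1 id]; rewrite ltn_eqF // bin_small //; lia.
  rewrite big_nat_recr //= eqxx binSn.
  by have := le d.+1 dj; lia.
have Tle : (halfdiff d.+1 <= halfdiff d)%N.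
  by case: (lev d dj) => [E|//]; rewrite E eqxx in Tlt.
have Td' : (halfdiff d <= d)%N by move/eqP: Tlt; lia.
move: (halfdiff d) (halfdiff d.+1) Tle Td' => t t' Tle Td' {Td Tlt}.
have sum_t : (\sum_(1 <= i < d.+1) (d - t < i)%N = t)%N.
  rewrite (@big_cat_nat _ _ _ (d - t).+1) //=; last by lia.
  rewrite big_nat_cond big1 => [|i]; last by rewrite andbT => /andP [_ id]; rewrite ltnNge -ltnS id.
  rewrite big_nat_cond (eq_bigr (fun=> 1%N)) => [|i]; last by rewrite andbT => /andP [-> _].
  by rewrite -big_nat_cond sum_nat_const_nat muln1 add0n; lia.
(* For t <= d the top t terms are C(i, i) = 1 and the others C(i-1, i) = 0. Raising both entries by
   one changes no term, so the bound is t itself. *)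
exists (fun i => if (d - t < i)%N then i else i.-1); rewrite /macaulay_rep /macaulay_upper.
split; first split.
- by move=> i i1 id; case: ifP; case: ifP; lia.
- rewrite -[LHS]sum_t; apply: eq_big_nat => i /andP [i1 _].
  by case: ifP => _; rewrite ?binn // bin_small //; lia.
rewrite (leq_trans Tle) // -[X in (X <= _)%N]sum_t leq_eqVlt; apply/orP; left; apply/eqP.
apply: eq_big_nat => i /andP [i1 _].
by case: ifP => _; rewrite ?binn // bin_small //; lia.
Qed.
End HilbertNumerics.

(** * Consequences of the prescribed quadrics *)

Section QuadricHypothesis.
Variables (K : closedFieldType) (I : {mpoly K[4]} -> Prop) (j : nat).
Local Notation P := {mpoly K[4]}.
Local Notation w := ('X_(inord 0) : P).
Local Notation x := ('X_(inord 1) : P).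
Local Notation y := ('X_(inord 2) : P).
Local Notation z := ('X_(inord 3) : P).
Hypotheses (iI : is_ideal I) (hI : forall p d, I p -> I (pihomog mdeg d p)).
Hypothesis I2 : forall p : P, p \is 2.-homog ->
  (I p <-> exists a b c : K, p = a *: (w * w) + b *: (w * x) + c *: (w * y)).

Lemma wX_homog k : w * 'X_k \is 2.-homog.
Proof. exact: (dhomogM (X_homog K (inord 0)) (X_homog K k)). Qed.

Lemma Iww : I (w * w).
Proof. by apply/(I2 (wX_homog _)); exists 1, 0, 0; rewrite !scale0r !addr0 scale1r. Qed.
Lemma Iwx : I (w * x).
Proof. by apply/(I2 (wX_homog _)); exists 0, 1, 0; rewrite !scale0r addr0 add0r scale1r. Qed.
Lemma Iwy : I (w * y).
Proof. by apply/(I2 (wX_homog _)); exists 0, 0, 1; rewrite !scale0r !add0r scale1r. Qed.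

(** No monomial of a quadric in [I] contains z. *)
Lemma linear_mul_z_notin (p : P) : p \is 1.-homog -> I (p * z) -> p = 0.
Proof.
move=> hp; have hpz : p * z \is 2.-homog.
  exact: (dhomogM hp (X_homog K (inord 3))).
move=> /(I2 hpz) [a [b [c E]]]; apply/mpolyP => m; rewrite mcoeff0.
have [/mdeg1P [k /eqP ->]|/negPf m1] := boolP (mdeg m == 1%N); last first.
  by apply: (dhomog_nemf_coeff hp); rewrite m1.
rewrite -(mcoeffMX p U_(inord 3)) E -!mpolyXD !mcoeffD !mcoeffZ !mcoeffX.
have ne l : (l < 3)%N -> (U_(inord 0) + U_(inord l) == U_(inord 3) + U_(k))%MM = false.
  move=> l3; apply/negP => /eqP /mnmP /(_ (inord 3)).
  rewrite !mnmDE !mnm1E -!(inj_eq val_inj) /= !inordK //; last by lia.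
  by rewrite (ltn_eqF l3).
by rewrite !ne // !mulr0 !addr0.
Qed.

Lemma linear_notin (p : P) : p \is 1.-homog -> I p -> p = 0.
Proof. by move=> hp Ip; apply: linear_mul_z_notin => //; apply: idealMl. Qed.

Lemma codim1 : codim 1 I = 4.
Proof.
have sI := ideal_subspace iI.
have -> : codim 1 I = \dim {: dhomog 4 K 1}.
  rewrite /codim (_ : piece 1 I = 0%VS) ?dimv0 ?subn0 //.
  apply/vspaceP => u; rewrite memv0; apply/idP/eqP => [/pieceP|->]; last by rewrite mem0v.
  move=> /(_ sI) /(linear_notin (dhomog_is_dhomog u)) u0; exact: val_inj.
by rewrite dimvf.
Qed.

(** Were w z^(k+1) in [I], all four variables would carry w z^k into [I], and duality would put w
    z^k itself in [I]. The descent ends at w and w z, which the quadrics exclude. *)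
Lemma wz_notin phi k : is_linear_form phi -> dual_generator phi j I ->
  (k < j)%N -> ~ I (w * z ^+ k).
Proof.
move=> lphi dI.
have w0 : w <> 0.
  by move/(congr1 (mcoeff U_(inord 0))); rewrite mcoeffX eqxx mcoeff0 => /eqP; rewrite oner_eq0.
have phi_I q : q \is j.-homog -> I q -> phi q = 0.
  move=> hq /(dI j q (leqnn j) hq) /(_ 1); rewrite subnn mulr1; apply; exact: dhomog1.
elim: k => [|k IHk] kj.
  by rewrite expr0 mulr1 => /(linear_notin (X_homog K _)).
case: k IHk kj => [|k] IHk kj.
  by rewrite expr1 => /(linear_mul_z_notin (X_homog K _)).
move=> Iwz; apply: (IHk (ltnW kj)).
have hwz : w * z ^+ k.+1 \is k.+2.-homog.
  have h := dhomogMn k.+1 (X_homog K (inord 3)).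
  by have := dhomogM (X_homog K (inord 0)) h; rewrite mul1n add1n.
have IM r q : I q -> I (r * q) by case: iI => _ _; apply.
apply/(dI k.+2 _ (ltnW kj) hwz) => q hq.
have ej : (j - k.+2 = (j - k.+3).+1)%N by lia.
move: hq; rewrite ej => hq; elim/homogS_ind: hq => {q} [c q1 q2 H1 H2||l q hq].
- by rewrite mulrDr -scalerAr lphi H1 H2 mulr0 addr0.
- by rewrite mulr0 (linear_form0 lphi).
apply: phi_I.
  have := dhomogM hwz (dhomogM (X_homog K l) hq).
  by rewrite (_ : (k.+2 + (1 + (j - k.+3)))%N = j) //; lia.
rewrite mulrA; apply: idealMl => //; rewrite mulrAC; case: (ord4E l) => ->.
- by apply: idealMl => //; exact: Iww.
- by apply: idealMl => //; exact: Iwx.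
- by apply: idealMl => //; exact: Iwy.
by rewrite -mulrA -exprS.
Qed.
End QuadricHypothesis.

(** [q] has finitely many roots in the domain K[y], while the constants are infinite in number. *)
Lemma exists_slice (K : closedFieldType) (q : {poly {poly K}}) :
  q != 0 -> exists a : K, q.[a%:P] != 0.
Proof.
move=> q0; have [s [us ss]] := closed_field_uniq_seq K (size q).
apply: NNPP => H.
have : (size (map (@polyC K) s) < size q)%N.
  apply: max_poly_roots => //; last by rewrite map_inj_uniq //; exact: polyC_inj.
  apply/allP => _ /mapP [a _ ->]; apply/negP => /negP h; apply: H; exists a.
  by move: h; rewrite /root.
by rewrite size_map ss ltnn.
Qed.

(* R = K[w,x,y,z] = {mpoly K[4]}, with w = 'X_0, x = 'X_1, y = 'X_2, z = 'X_3. *)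
Theorem theorem3p20 (K : closedFieldType) (I : {mpoly K[4]} -> Prop)
    (j : nat) (H : nat -> nat) :
  graded_artinian_gorenstein I ->
  hilbert_function I H ->
  socle_degree H j ->
  (* I_2 = < w^2, wx, wy > *)
  (forall p : {mpoly K[4]}, p \is 2.-homog ->
     (I p <-> exists a b c : K,
        p = a *: ('X_(inord 0) * 'X_(inord 0))
          + b *: ('X_(inord 0) * 'X_(inord 1))
          + c *: ('X_(inord 0) * 'X_(inord 2)))) ->
  O_sequence (DeltaH_half H j) /\
  exists (J : {mpoly K[3]} -> Prop) (H' : nat -> nat),
    [/\ graded_artinian_gorenstein J, hilbert_function J H' & H' 1%N = 3%N] /\
    (* H' has length j+1 and H = H' + (0,1,...,1,0) *)
    [/\ (forall i, (j < i)%N -> H' i = 0%N),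
        H 0%N = H' 0%N, H j = H' j &
        (forall i, (0 < i < j)%N -> H i = (H' i + 1)%N)].
Proof.
move=> GI Hf [Hj Hhigh] I2.
have [[iI hI] [d artin]] : is_homogeneous_ideal I /\
    exists d, forall p : {mpoly K[4]}, p \is d.-homog -> I p.
  by case: GI.
have sI := ideal_subspace iI.
have -> : H = (fun i => codim i I).
  by apply: functional_extensionality => i; apply: dim_mod_inj (Hf i) (dim_mod_codim i sI).
have HE i : H i = codim i I := dim_mod_inj (Hf i) (dim_mod_codim i sI).
have [g hg Ig] : exists2 g : {mpoly K[4]}, g \is j.-homog & ~ I g.
  have /subvPn [u _ uI] : ~~ (fullv <= piece j I)%VS.
    apply: contraTN Hj => /dimvS full; rewrite HE -eqn0Ngt /codim subn_eq0.
    exact: full.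
  exists (u : {mpoly K[4]}); first exact: dhomog_is_dhomog.
  by move=> Iu; case/negP: uI; apply/pieceP.
have topI (p : {mpoly K[4]}) : p \is j.+1.-homog -> I p.
  move=> hp; have := Hhigh j.+1 (ltnSn j); rewrite HE /codim => /eqP.
  rewrite subn_eq0 => full.
  have /eqP E : piece j.+1 I == fullv by rewrite eqEdim subvf.
  have : (DHomog hp) \in piece j.+1 I by rewrite E memvf.
  by move=> /pieceP; apply.
have [phi [lphi dI]] := gorenstein_dual_generator GI hg Ig topI.
have h_sym i : (i <= j)%N -> codim i I = codim (j - i) I by exact: codim_sym lphi iI dI.
have h1 := codim1 iI I2.
have h0 : codim 0 I = 1%N.
  have : (0 < codim 0 I)%N by rewrite h_sym // subn0 -HE.
  have : (codim 0 I <= \dim {: dhomog 4 K 0})%N by exact: leq_subr.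
  rewrite dimvf [dim _]/=; move: (codim 0 I) => [|[|c]] //.
have j_gt0 : (0 < j)%N.
  by rewrite lt0n; apply/eqP => j0; have := Hhigh 1%N; rewrite j0 HE h1 => /(_ isT).
have low0 (p : {mpoly K[4]}) i : (i < 3)%N -> p \is i.-homog -> I p -> Psi p = 0.
  case: i => [|[|[|i]]] // _ hp Ip.
  - have /eqP : (1 + \dim (piece 0 I) = 1)%N.
      rewrite -{1}h0 /codim subnK ?dimvS ?subvf //; last by rewrite dimvf.
    rewrite -[X in _ == X]addn0 eqn_add2l dimv_eq0 => /eqP E.
    have : DHomog hp \in piece 0 I by apply/pieceP.
    by rewrite E memv0 => /eqP /(congr1 (@mpoly_of_dhomog _ _ _)) /= ->; rewrite Psi0.
  - by rewrite (linear_notin iI I2 hp Ip) Psi0.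
  have [a [b [c ->]]] := (I2 p hp).1 Ip.
  by rewrite !PsiD !PsiZ !PsiM Psi_w !mul0r !mulr0 !addr0.
have [nu [[f [hf If f0]] least]] : exists i,
    (exists p : {mpoly K[4]}, [/\ p \is i.-homog, I p & Psi p <> 0]) /\
    forall k, (k < i)%N -> ~ (exists p : {mpoly K[4]}, [/\ p \is k.-homog, I p & Psi p <> 0]).
  (* All forms of degree [d] lie in [I], in particular x^d, which [Psi] sends to 1. *)
  apply: exists_least; exists d, ('X_(inord 1) ^+ d).
  have hx : ('X_(inord 1) ^+ d : {mpoly K[4]}) \is d.-homog.
    by have := dhomogMn d (X_homog K (inord 1)); rewrite mul1n.
  split=> //; first exact: artin.
  by rewrite PsiXn Psi_x expr1n => /eqP; rewrite oner_eq0.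
have vanish k (p : {mpoly K[4]}) : (k < nu)%N -> p \is k.-homog -> I p -> Psi p = 0.
  move=> kn hp Ip; apply: NNPP => p0; apply: (least k kn); by exists p.
have nu_gt2 : (2 < nu)%N.
  by rewrite ltnNge; apply/negP => n2; apply: f0; apply: low0 hf If.
(* A single form [f] of degree [nu] decides [a]: below [nu] the image of [I] vanishes for every [a],
   and in degree [nu] one nonzero slice suffices. *)
have [a fa] : exists a : K, (Psi f).[a%:P] != 0 by apply: exists_slice; apply/eqP.
have Sl i := constructive_indefinite_description _
  (slice_image a iI hI (Iww I2) (Iwx I2) (Iwy I2) i).
pose V i := proj1_sig (Sl i).
have VP i v : v \in V i <-> exists2 p, p \is i.-homog /\ I p & v = poly_rV (psi a p).
  exact: (proj2_sig (Sl i)).1.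
pose h i := codim i I; pose c i := codim i (hyperplane I a).
pose r i := codim i (fun p => I (ell a * p)); pose v i := \dim (V i).
have h_exact i : h i.+1 = (c i.+1 + r i)%N by exact: codim_exact.
have r_sym i : (i < j)%N -> r i = r (j.-1 - i)%N.
  move=> ij; rewrite -subn1; apply: (codim_colon_sym lphi iI dI (ell_homog a)); lia.
have c_v i : (1 < i)%N -> (c i + v i = i.+1)%N by exact: (proj2_sig (Sl i)).2.
have v_lt i : (1 < i)%N -> (0 < v i)%N -> (v i < v i.+1)%N.
  (* After setting x = 1, multiplication by x is the identity and multiplication by y is
     multiplication by ['X]. *)
  move=> i1; apply: dim_shift_lt => _ /VP [p [hp Ip] ->].
  rewrite poly_rV_K; last exact: size_psi.
  have IM q s : I s -> I (q * s) by case: iI => _ _; apply.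
  have hX k : 'X_k * p \is i.+1.-homog.
    by rewrite -[i.+1]add1n; apply: dhomogM => //; apply: X_homog.
  split; apply/VP.
    exists ('X_(inord 1) * p); first by split; [apply: hX | apply: IM].
    by rewrite psiM [psi a 'X_(inord 1)]/psi Psi_x hornerC mul1r.
  exists ('X_(inord 2) * p); first by split; [apply: hX | apply: IM].
  by rewrite psiM [psi a 'X_(inord 2)]/psi Psi_y hornerC.
have v_low i : (1 < i)%N -> (i < nu)%N -> v i = 0%N.
  move=> _ inu; apply/eqP; rewrite dimv_eq0 -subv0; apply/subvP => u /VP [p [hp Ip] ->].
  by rewrite /psi (vanish i p) // horner0 linear0 mem0v.
have v_nu : (0 < v nu)%N.
  rewrite lt0n dimv_eq0; apply/eqP => V0.
  have : poly_rV (psi a f) \in V nu by apply/VP; exists f.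
  rewrite V0 memv0 => /eqP E; case/negP: fa.
  by rewrite -/(psi a f) -(poly_rV_K (size_psi a hf)) E linear0.
have r_low i : (0 < i)%N -> (i.+1 < nu)%N -> (i < j)%N -> r i = h i.
  case: i => [//|i] _ inu ij; rewrite /r /h /codim; congr (_ - \dim _)%N.
  have sC := colon_subspace a iI.
  apply/vspaceP => u; apply/idP/idP => /pieceP H1; apply/pieceP => //.
    have := H1 sC; apply: (colon_ell_trivial iI (Iww I2) (Iwx I2) (Iwy I2)).
    - by move=> q hq; apply: (vanish i.+2 q inu hq).
    - exact: (wz_notin iI I2 lphi dI ij).
    exact: dhomog_is_dhomog.
  by case: iI => _ _; apply; apply: H1.
have [j4 h2] := socle_degree_ge4 h_exact h_sym c_v nu_gt2 v_low v_nu r_low h0 h1 j_gt0.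
split.
  exact: (halfdiff_O_sequence h_exact r_sym h_sym c_v v_lt nu_gt2 v_low v_nu r_low h0 h1 j_gt0).
have [up le lev] := halfdiff_spec h_exact r_sym h_sym c_v v_lt nu_gt2 v_low v_nu r_low h0 h1 j_gt0.
have hsum := hilbert_sum h_exact r_sym h_sym c_v v_lt nu_gt2 v_low v_nu r_low h0 h1 j_gt0.
(* With [s = j./2], every degree up to [j] is at most [s] or symmetric to one that is. *)
have ss : (j./2 + j./2 <= j)%N by lia.
have [J [H' [GJ HJ H'low H'sym H'high]]] :=
  @gorenstein_of_staircase K j./2 j (halfdiff h) ss isT le lev.
have H'0 : H' 0%N = 1%N by rewrite H'low // big_ord1.
exists J, H'; split; split=> //.
- by rewrite H'low; [rewrite !big_ord_recr big_ord0 | lia].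
- by rewrite h0 H'0.
- by rewrite h_sym // subnn h0 H'sym // subnn H'0.
move=> i /andP [i0 ij].
have [is_|is_] := leqP i j./2; first by rewrite H'low // -hsum.
rewrite h_sym 1?ltnW // H'sym 1?ltnW // H'low; last by lia.
by rewrite -hsum //; lia.
Qed.
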